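(* For every spherically convex set $\Omega\subset S^2$, $$\beta(\Omega)=\frac{\pi^2}{2}\alpha(\Omega)+\gamma(\Omega),$$ where $$\gamma(\Omega)=\frac18\int_{v\in\tilde\Omega,\ \pm u\notin\Omega}\bigl(\mathcal{D}^{2}(\Omega,u)-\sin^{2}\mathcal{D}(\Omega,u)\bigr)\,|\langle v,u\rangle|\,dv\,du ,$$ the integral being over pairs $(v,u)\in\tilde\Omega\times S^2$ such that neither $u$ nor $-u$ belongs to $\Omega$.
   Context: $S^2\subset\mathbb{R}^3$ is the unit sphere and $du,dv,dv_i$ denote its surface (Lebesgue) measure. A spherically convex set is here a nonempty closed set $\Omega\subset S^2$ such that the cone $\{tu:t\ge0,u\in\Omega\}$ is convex and contains no line (as is the case for the visual solid angle of a compact convex set from an exterior point). Let $\tilde\Omega=\{v\in S^2: v^{\perp}\cap\Omega\ne\emptyset\}$, where $v^\perp$ is the plane through the origin orthogonal to $v$. Define $$\alpha(\Omega)=\frac12\int_{u\in\Omega,\ v\in\tilde\Omega}|\langle u,v\rangle|\,du\,dv,\qquad \beta(\Omega)=\frac18\int_{v_1,v_2,v_3\in\tilde\Omega}|\det(v_1,v_2,v_3)|\,dv_1\,dv_2\,dv_3 .$$ For $u\in S^2$ with $\pm u\notin\Omega$, the dihedral visual angle $\mathcal{D}(\Omega,u)\in[0,\pi)$ is the measure of the dihedral angle containing $\Omega$ with edge the line $\mathbb{R}u$ and bounded by the two planes through the origin and $u$ tangent to $\Omega$; equivalently, it is the opening angle of the planar convex cone obtained by orthogonally projecting the cone $\{tw:t\ge0,w\in\Omega\}$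 onto $u^{\perp}$. *)

(* Defs.v *)
From HB Require Import structures.
From mathcomp Require Import all_boot all_order all_algebra.
From mathcomp Require Import ring.
From mathcomp Require Import all_classical all_reals all_analysis.
From mathcomp Require Import measurable_realfun.

Set Implicit Arguments.
Unset Strict Implicit.
Unset Printing Implicit Defensive.

Import Order.TTheory GRing.Theory Num.Theory.
Import numFieldNormedType.Exports.

Local Open Scope classical_set_scope.
Local Open Scope ring_scope.

(* [measurableTypeR R] is [R] with its Borel sigma-algebra, the type on which
   the library's [lebesgue_measure] lives.  A notation rather than a
   definition, so that the topology, the module structure and the product
   sigma-algebra are all inferred. *)
Notation E3 R :=
  (measurableTypeR R * measurableTypeR R * measurableTypeR R)%type.

Section euclidean_space.
Context {R : realType}.
Implicit Types u v w x : E3 R.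

Definition dot u v : R := u.1.1 * v.1.1 + u.1.2 * v.1.2 + u.2 * v.2.

(* The library's norm [`|u|] on a product type is the sup norm. *)
Definition enorm u : R := Num.sqrt (dot u u).

Definition row3 u : 'rV[R]_3 := \row_(j < 3) [:: u.1.1; u.1.2; u.2]`_j.

Definition det3 u v w : R := \det (\matrix_(i < 3) row3 [:: u; v; w]`_i).

Definition sphere : set (E3 R) := [set u | enorm u = 1].

Definition lebesgue3 : {measure set (E3 R) -> \bar R} :=
  ((@lebesgue_measure R \x @lebesgue_measure R) \x @lebesgue_measure R)%E.

(* Surface measure of the unit sphere, as a measure on the ambient space
   carried by [sphere]: the area of A is three times the volume of the
   truncated cone {t u : 0 < t <= 1, u in A}. *)
Definition surface (A : set (E3 R)) : \bar R :=
  (3%:E * lebesgue3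
     [set (t *: u : E3 R) | t in `]0%R, 1%R] & u in A `&` sphere])%E.

End euclidean_space.

Section surface_measure.
Context {R : realType}.
Implicit Types u v w x : E3 R.

Let normalize x : E3 R := (enorm x)^-1 *: x.

Let pball : set (E3 R) := [set x | 0 < enorm x <= 1].

Let dotZ (t : R) x : dot (t *: x) (t *: x) = t ^+ 2 * dot x x.
Proof. rewrite /dot /=/GRing.scale/=; ring. Qed.

Let dot_ge0 x : 0 <= dot x x.
Proof. by rewrite /dot -!expr2 !addr_ge0 ?sqr_ge0. Qed.

Let enormZ (t : R) x : 0 <= t -> enorm (t *: x) = t * enorm x.
Proof.
by move=> t0; rewrite /enorm dotZ sqrtrM ?sqr_ge0// sqrtr_sqr ger0_norm.
Qed.

Let coneE (A : set (E3 R)) :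
  [set (t *: u : E3 R) | t in `]0%R, 1%R] & u in A `&` sphere] =
  normalize @^-1` A `&` pball.
Proof.
apply/seteqP; split=> [x [t /=]|x [/= Ax /andP[x0 x1]]].
  rewrite in_itv/= => /andP[t0 t1] [u [Au su]] <-.
  have tE : enorm (t *: u) = t by rewrite enormZ ?ltW// su mulr1.
  split; last by rewrite /pball/= [enorm _]tE t0.
  by rewrite /= /normalize [enorm _]tE scalerA mulVf ?gt_eqF// scale1r.
exists (enorm x); first by rewrite /= in_itv/= x0.
exists (normalize x); first split=> //.
  by rewrite /sphere/= enormZ ?invr_ge0 ?ltW// mulVf// gt_eqF.
by rewrite /normalize scalerA mulfV ?gt_eqF// scale1r.
Qed.

Let mc1 : measurable_fun [set: E3 R] (fun x => x.1.1 : R).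
Proof. exact: (measurableT_comp (f := fst) measurable_fst measurable_fst). Qed.

Let mc2 : measurable_fun [set: E3 R] (fun x => x.1.2 : R).
Proof. exact: (measurableT_comp (f := snd) measurable_snd measurable_fst). Qed.

Let mc3 : measurable_fun [set: E3 R] (fun x => x.2 : R).
Proof. exact: measurable_snd. Qed.

Let mdot : measurable_fun [set: E3 R] (fun x => dot x x : R).
Proof.
by apply: measurable_funD; [apply: measurable_funD|]; apply: measurable_funM.
Qed.

Let menorm : measurable_fun [set: E3 R] (@enorm R : _ -> R).
Proof.
rewrite [X in measurable_fun _ X](_ : _ = fun x => dot x x `^ 2^-1).
  exact: (measurableT_comp (measurable_powR _)).
by apply/funext => x; rewrite powR12_sqrt.
Qed.

Let minvnorm : measurable_fun [set: E3 R] (fun x => (enorm x)^-1 : R).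
Proof.
rewrite [X in measurable_fun _ X](_ : _ = fun x => enorm x `^ (-1)).
  exact: (measurableT_comp (measurable_powR _)).
by apply/funext => x; rewrite powR_inv1// sqrtr_ge0.
Qed.

Let mnormalize : measurable_fun [set: E3 R] normalize.
Proof.
apply: measurable_fun_pair => /=.
  apply: measurable_fun_pair => /=; exact: measurable_funM.
exact: measurable_funM.
Qed.

Let mpball : measurable pball.
Proof.
rewrite (_ : pball = @enorm R @^-1` `]0, 1]%classic).
  rewrite -[X in measurable X]setTI; exact: menorm.
by apply/seteqP; split=> x /=; rewrite in_itv.
Qed.

Let pball_fin : (lebesgue3 pball < +oo)%E.
Proof.
pose I : set (measurableTypeR R) := `[-1, 1]%classic.
have mI : measurable I by exact: measurable_itv.
have coord_le (a b : R) : 0 <= b -> Num.sqrt (a ^+ 2 + b) <= 1 ->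
    -1 <= a <= 1.
  move=> b0 h; rewrite -ler_norml -sqrtr_sqr (le_trans _ h)// ler_sqrt.
    by rewrite lerDl.
  by rewrite addr_ge0 ?sqr_ge0.
have sub : pball `<=` (I `*` I) `*` I.
  move=> x /andP[_]; rewrite /enorm /dot -!expr2 => x1.
  split; first split; rewrite /I/= in_itv/=.
  - by apply: coord_le (x.1.2 ^+ 2 + x.2 ^+ 2) _ _;
      rewrite ?addr_ge0 ?sqr_ge0// addrA.
  - apply: coord_le (x.1.1 ^+ 2 + x.2 ^+ 2) _ _;
      rewrite ?addr_ge0 ?sqr_ge0//.
    by rewrite addrCA addrA.
  - apply: coord_le (x.1.1 ^+ 2 + x.1.2 ^+ 2) _ _;
      rewrite ?addr_ge0 ?sqr_ge0//.
    by rewrite addrC.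
have mI2 : measurable (I `*` I) by exact: measurableX.
have I2 : lebesgue_measure I = 2%:E.
  by rewrite /I lebesgue_measure_itv/= lte_fin gtrN ?ltr01// -EFinB opprK.
have I3 : lebesgue3 ((I `*` I) `*` I) =
    (lebesgue_measure I * lebesgue_measure I * lebesgue_measure I)%E.
  rewrite [LHS]product_measure1E//; congr (_ * _)%E.
  exact: product_measure1E.
have : (lebesgue3 ((I `*` I) `*` I) < +oo)%E by rewrite I3 I2 -!EFinM ltry.
apply: le_lt_trans; apply: le_measure => //; rewrite inE//.
exact: measurableX.
Qed.

Let image_measure : {measure set (E3 R) -> \bar R} :=
  measure_function_pushforward__canonical__measure_function_Measure
    (mfrestr mpball pball_fin) mnormalize.

Let surfaceE A : surface A = mscale 3%:R%:nng image_measure A.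
Proof. by rewrite /surface coneE. Qed.

Let surface0 : surface (set0 : set (E3 R)) = 0%E.
Proof. by rewrite surfaceE measure0. Qed.

Let surface_ge0 (A : set (E3 R)) : (0 <= surface A)%E.
Proof. by rewrite surfaceE measure_ge0. Qed.

Let surface_sigma_additive : semi_sigma_additive (@surface R).
Proof.
rewrite [X in semi_sigma_additive X](_ : _ =
  mscale 3%:R%:nng image_measure).
  exact: measure_semi_sigma_additive.
by apply/funext => A; exact: surfaceE.
Qed.

HB.instance Definition _ := isMeasure.Build _ (E3 R) R (@surface R)
  surface0 surface_ge0 surface_sigma_additive.

Let surface_fin : fin_num_fun (@surface R).
Proof.
move=> A mA; rewrite surfaceE fin_numM// fin_num_measure//.
by rewrite -[X in measurable X]setTI; exact: mnormalize.
Qed.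

HB.instance Definition _ :=
  Measure_isFinite.Build _ (E3 R) R (@surface R) surface_fin.

End surface_measure.

Section visual_cones.
Context {R : realType}.
Implicit Types (u v w x y : E3 R) (Om C K : set (E3 R)).

Definition cone Om : set (E3 R) :=
  [set (t *: u : E3 R) | t in `[0%R, +oo[ & u in Om].

Definition contains_line C : Prop :=
  exists a d : E3 R, d != 0 /\ forall s : R, C (a + s *: d).

Definition spherically_convex Om : Prop :=
  [/\ Om !=set0, closed Om, Om `<=` sphere, convex_set (cone Om)
    & ~ contains_line (cone Om)].

Definition tilde Om : set (E3 R) :=
  [set v | sphere v /\ exists2 w, Om w & dot v w = 0].

Definition alpha Om : \bar R :=
  ((2^-1)%:E *
   \int[surface \x surface]_(p in Om `*` tilde Om) `|dot p.1 p.2|%:E)%E.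

Definition beta Om : \bar R :=
  ((8^-1)%:E *
   \int[surface \x surface \x surface]_(p in tilde Om `*` tilde Om `*` tilde Om)
      `|det3 p.1.1 p.1.2 p.2|%:E)%E.

(* Orthogonal projection onto the plane orthogonal to the unit vector [u]. *)
Definition orth_proj u w : E3 R := w - dot w u *: u.

Definition angle x y : R := acos (dot x y / (enorm x * enorm y)).

(* Opening angle of a convex cone containing no line: the largest angle between
   two of its rays.  For a closed planar cone this is the angle between the two
   bounding rays, and it is less than pi. *)
Definition opening_angle K : R :=
  sup [set angle x y | x in K `\ 0 & y in K `\ 0].

(* Dihedral visual angle, meaningful for [u] on the sphere with +-u not in Om. *)
Definition dihedral Om u : R := opening_angle (orth_proj u @` cone Om).

Definition outside Om : set (E3 R) :=
  [set u | [/\ sphere u, ~ Om u & ~ Om (- u)]].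

Definition gamma Om : \bar R :=
  ((8^-1)%:E *
   \int[surface \x surface]_(p in tilde Om `*` outside Om)
     ((dihedral Om p.2 ^+ 2 - sin (dihedral Om p.2) ^+ 2) * `|dot p.1 p.2|)%:E)%E.

End visual_cones.

(* Main.v *)
Require Import Defs.
From HB Require Import structures.
From mathcomp Require Import all_boot all_order all_algebra.
From mathcomp Require Import all_classical all_reals all_analysis.
From mathcomp Require Import measurable_realfun.
From mathcomp Require Import ring lra.

Set Implicit Arguments.
Unset Strict Implicit.
Unset Printing Implicit Defensive.

Import Order.TTheory GRing.Theory Num.Theory.
Import numFieldNormedType.Exports.

Local Open Scope classical_set_scope.
Local Open Scope ring_scope.

(** Fix a unit vector v and sort the pairs (v1, v2) by the line R u orthogonal
    to both.  If v1 and v2 have polar angles s and t in the plane orthogonal to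
    u, then det(v1, v2, v) = +- sin(s - t) <u, v>, while the area elements
    satisfy dv1 dv2 = |sin(s - t)| ds dt du / 2, the factor 1/2 because u and
    -u give the same plane.  Integrating over v1 and v2 in the set [tilde Om],
    then over v in it, beta becomes
      1/16 int_v int_u |<u, v>| W(u) du dv,
    where W(u) is the integral of sin^2(s - t) over the pairs of directions
    that lie in [tilde Om] and are orthogonal to u ([integral_det_pair], with W
    called [plane_weight]).  If u or -u is in Om, all directions orthogonal to u
    qualify and W(u) = 2 pi^2.  Otherwise they are the directions orthogonal to some ray
    of the projected cone, which form two opposite arcs of length D, the
    dihedral angle, and W(u) = 2 (D^2 - sin^2 D).  As Om and -Om are disjoint
    and contribute equally, the first case yields (pi^2 / 2) alpha and the
    second yields gamma.

    The proof works with volumes instead of polar coordinates.  Surface measure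
    is the volume of truncated cones, so a spherical integral is an integral
    over the unit ball ([integral_surface]).  The change of variables above is
    linear once two coordinates are kept: for x = (x', s) and y = (y', t) in
    R^2 x R, the system s = - <c, x'>, t = - <c, y'> determines c in R^2, that
    is the plane orthogonal to (c, 1) through x and y, and its Jacobian is the
    area |x' /\ y'| ([integral_pencil]).  The unit vectors u are likewise
    parametrized, up to sign, by the points (c, 1) of an affine plane
    ([integral_surface_chart]).  There remains a quadruple integral in the plane
    orthogonal to u, of (p /\ q)^2 for p and q in a double sector of the unit
    disc.  In orthonormal coordinates along the bisector of the projected cone
    ([sector_frame]) it is twice the product of the two second moments of the
    sector ([integral_wedge_sqr]); these are computed by slopes, with
    antiderivatives made of the arctangent ([sector_moment1],
    [sector_moment2]).

    All integrands are nonnegative, so Tonelli's theorem applies once they are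
    known to be measurable.  For the dihedral angle this holds because it is
    a supremum of angles that depend continuously on u
    ([measurable_dihedral]). *)

(** * Affine substitutions on the line *)
Section line.
Context {R : realType}.
Local Notation T1 := (measurableTypeR R).
Local Notation mu := (@lebesgue_measure R).
Implicit Type f : T1 -> \bar R.

Lemma measurable_affine (c d : R) :
  measurable_fun [set: T1] (fun x : T1 => c * x + d : T1).
Proof. by apply: measurable_funD => //; exact: measurable_funM. Qed.

Let image_measure c d : {measure set T1 -> \bar R} :=
  measure_function_pushforward__canonical__measure_function_Measure
    mu (measurable_affine c d).

Lemma integral_affine (c d : R) f : c != 0 ->
  measurable_fun setT f -> (forall x, 0 <= f x)%E ->
  (`|c|%:E * \int[mu]_x f (c * x + d)%R = \int[mu]_x f x)%E.
Proof.
move=> c0 mf f0.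
have nc0 : 0 <= `|c| by [].
transitivity (\int[mscale (NngNum nc0) (image_measure c d)]_x f x)%E.
  rewrite ge0_integral_mscale//; congr (_ * _)%E.
  by rewrite ge0_integral_pushforward//; exact: measurable_affine.
apply: eq_measure_integral => A mA _; symmetry.
apply: lebesgue_measure_unique => //= _ [[a b]] _ <-.
rewrite /mscale/= /pushforward.
have [cp|cn|/eqP] := ltgtP 0 c; last by rewrite eq_sym (negbTE c0).
- rewrite (_ : _ @^-1` _ = `](a - d) / c, (b - d) / c]%classic); last first.
    apply/seteqP; split=> x /=; rewrite !in_itv/= ltr_pdivrMr// ler_pdivlMr//
      [x * c]mulrC; lra.
  rewrite !lebesgue_measure_itv/= !lte_fin ltr_pM2r ?invr_gt0// ltrD2r.
  case: ifP => _; last by rewrite mule0.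
  by rewrite -!EFinB -EFinM gtr0_norm//; congr EFin; field.
- rewrite (_ : _ @^-1` _ = `[(b - d) / c, (a - d) / c[%classic); last first.
    apply/seteqP; split=> x /=; rewrite !in_itv/= ltr_ndivlMr// ler_ndivrMr//
      [x * c]mulrC; lra.
  rewrite !lebesgue_measure_itv/= !lte_fin ltr_nM2r ?invr_lt0// ltrD2r.
  case: ifP => _; last by rewrite mule0.
  by rewrite -!EFinB -EFinM ltr0_norm//; congr EFin; field.
Qed.

Lemma eq_integral_except1 (c : R) f g :
  measurable_fun setT f -> measurable_fun setT g ->
  (forall x, x != c -> f x = g x) -> (\int[mu]_x f x = \int[mu]_x g x)%E.
Proof.
move=> mf mg fg.
have mD : measurable ([set: R] `\ c) by apply: measurableD.
rewrite -(@integral_setD1 _ f c)//; last exact: measurable_funTS.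
rewrite -(@integral_setD1 _ g c)//; last exact: measurable_funTS.
by apply: eq_integral => x; rewrite inE/= => -[_ /eqP/fg].
Qed.

End line.

(** * Measurability of elementary expressions *)
Lemma measurable_fun_inv d (T : measurableType d) (R : realType)
    (f : T -> R) : measurable_fun [set: T] f ->
  measurable_fun [set: T] (fun x => (f x)^-1).
Proof.
move=> mf.
have mV : measurable_fun [set: R] (fun x : R => x^-1).
  rewrite (_ : setT = [set x | x != 0] `|` [set 0]); last first.
    by apply/seteqP; split=> // x _ /=; case: (eqVneq x 0); [right|left].
  have o0 : open [set x : R | x != 0] by exact: open_neq.
  apply/measurable_funU => //; first exact: open_measurable.
  split; last exact: measurable_fun_set1.
  apply: open_continuous_measurable_fun => //.
  by move=> x /[!inE]/= x0; exact: inv_continuous.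
exact: (measurableT_comp mV).
Qed.

Lemma measurable_fun_sqrt d (T : measurableType d) (R : realType)
    (f : T -> R) : measurable_fun [set: T] f ->
  measurable_fun [set: T] (fun x => Num.sqrt (f x)).
Proof.
move=> mf; apply: (measurableT_comp _ mf); apply: continuous_measurable_fun.
exact: sqrt_continuous.
Qed.

Lemma measurable_fun_inset d (T : measurableType d) d' (T' : measurableType d')
  (R : realType) (A : set T') (f : T -> T') : measurable A ->
  measurable_fun [set: T] f ->
  measurable_fun [set: T] (fun x => \1_A (f x) : R).
Proof.
move=> mA mf.
have m1 : measurable_fun setT (\1_A : T' -> R) by exact: measurable_indic.
exact: (measurableT_comp m1 mf).
Qed.

(* Decomposes the measurability of a function along its body; a function known
   to be measurable is recognized as the head of an application. *)
Ltac msr_step := lazymatch goal with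
  | |- measurable_fun _ (fun x => EFin (@?f x)) => apply/measurable_EFinP
  | |- measurable_fun _ (fun x => fst (@?f x)) =>
      apply: (measurableT_comp (f := fst) measurable_fst)
  | |- measurable_fun _ (fun x => snd (@?f x)) =>
      apply: (measurableT_comp (f := snd) measurable_snd)
  | |- measurable_fun _ (fun x => (@?f x, @?g x)) =>
      apply: measurable_fun_pair
  | |- measurable_fun _ (fun x => (@?f x * @?g x)%E) => apply: emeasurable_funM
  | |- measurable_fun _ (fun x => (@?f x + @?g x)%E) => apply: emeasurable_funD
  | |- measurable_fun _ (fun x => @?f x + - @?g x) => apply: measurable_funB
  | |- measurable_fun _ (fun x => @?f x + @?g x) => apply: measurable_funD
  | |- measurable_fun _ (fun x => @?f x * @?g x) => apply: measurable_funM
  | |- measurable_fun _ (fun x => - @?f x) => apply: measurable_funN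
  | |- measurable_fun _ (fun x => (@?f x) ^+ _) => apply: measurable_funX
  | |- measurable_fun _ (fun x => (@?f x)^-1) => apply: measurable_fun_inv
  | |- measurable_fun _ (fun x => Num.sqrt (@?f x)) =>
      apply: measurable_fun_sqrt
  | |- measurable_fun _ (fun x => \1_ ?A (@?f x)) => apply: measurable_fun_inset
  | |- measurable_fun _ (fun x => `| @?f x |) =>
      apply: (measurableT_comp (@normr_measurable _ _))
  | mh : measurable_fun _ ?h |- measurable_fun _ (fun x => ?h (@?f x)) =>
      apply: (measurableT_comp mh)
  | |- _ => first [assumption | exact: measurable_id | exact: measurable_cst
                  | by []]
  end.
Ltac msr := repeat msr_step.

(** * Tonelli's theorem and linear substitutions in the plane *)
Section shear.
Context {R : realType} d (T : measurableType d).
Local Notation T1 := (measurableTypeR R).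
Local Notation mu := (@lebesgue_measure R).
Variable m : {sigma_finite_measure set T -> \bar R}.

Lemma integral_shear (c a : T -> R) (f : T * T1 -> \bar R) :
  measurable_fun setT c -> measurable_fun setT a -> measurable_fun setT f ->
  (forall x, c x != 0) -> (forall x, 0 <= f x)%E ->
  (\int[m \x mu]_z (`|c z.1|%:E * f (z.1, (c z.1 * z.2 + a z.1)%R)) =
   \int[m \x mu]_z f z)%E.
Proof.
move=> mc ma mf c0 f0.
rewrite fubini_tonelli1//; last by move=> z; rewrite mule_ge0.
  rewrite [RHS](fubini_tonelli1 _ mf f0); apply: eq_integral => x _ /=.
  rewrite /fubini_F/= ge0_integralZl//.
    rewrite (@integral_affine R (c x) (a x) (fun y => f (x, y)))//.
    exact: measurableT_comp.
  apply: (measurableT_comp mf); apply: measurable_fun_pair => //=.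
  exact: measurable_affine.
msr.
Qed.
End shear.

Section sigma_finite_product.
Local Open Scope ereal_scope.
Context d1 d2 (T1 : measurableType d1) (T2 : measurableType d2) (R : realType).
Variables (m1 : {sigma_finite_measure set T1 -> \bar R})
          (m2 : {sigma_finite_measure set T2 -> \bar R}).

(** The product of two sigma-finite measures, bundled as a sigma-finite measure
    so that products can be iterated. *)
Definition sf_product : set (T1 * T2) -> \bar R := (m1 \x m2).

HB.instance Definition _ := Measure.on sf_product.

Let sf_product_sigma_finite : sigma_finite setT sf_product.
Proof.
have /sigma_finiteP[F [TF ndF Foo]] := sigma_finiteT m1.
have /sigma_finiteP[G [TG ndG Goo]] := sigma_finiteT m2.
exists (fun n => F n `*` G n) => [|n].
  apply/esym/seteqP; split=> // -[x y] _.
  have [n _ Fx] : (\bigcup_n F n) x by rewrite -TF.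
  have [k _ Gy] : (\bigcup_n G n) y by rewrite -TG.
  exists (maxn n k) => //; split=> /=.
    by move: Fx; exact/subsetPset/ndF/leq_maxl.
  by move: Gy; exact/subsetPset/ndG/leq_maxr.
have [mF Fn] := Foo n; have [mG Gn] := Goo n.
split; first exact: measurableX.
by rewrite /sf_product product_measure1E// lte_mul_pinfty// ge0_fin_numE.
Qed.

HB.instance Definition _ :=
  Measure_isSigmaFinite.Build _ _ _ sf_product sf_product_sigma_finite.

Lemma integral_sf_product (f : T1 * T2 -> \bar R) :
  measurable_fun setT f -> (forall z, 0 <= f z) ->
  \int[sf_product]_z f z = \int[m1]_x \int[m2]_y f (x, y).
Proof. by move=> mf f0; rewrite [LHS]fubini_tonelli1. Qed.

Lemma measurable_fun_integral (f : T1 -> T2 -> \bar R) :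
  measurable_fun setT (fun z : T1 * T2 => f z.1 z.2) ->
  (forall x y, 0 <= f x y) -> measurable_fun setT (fun x => \int[m2]_y f x y).
Proof.
by move=> mf f0; exact: (measurable_fun_fubini_tonelli_F
  (fun z : T1 * T2 => f z.1 z.2)).
Qed.

End sigma_finite_product.

Definition area {R : realType} :
    {sigma_finite_measure set (measurableTypeR R * measurableTypeR R)%type -> \bar R} :=
  sf_product (@lebesgue_measure R) (@lebesgue_measure R).

Section plane.
Context {R : realType}.
Local Notation T1 := (measurableTypeR R).
Local Notation T2 := (T1 * T1)%type.
Local Notation mu := (@lebesgue_measure R).
Implicit Type f : T2 -> \bar R.

Lemma integral_area f : measurable_fun setT f -> (forall z, 0 <= f z)%E ->
  (\int[area]_z f z = \int[mu]_x \int[mu]_y f (x, y))%E.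
Proof. by move=> mf f0; rewrite [LHS]integral_sf_product. Qed.

Lemma integral_swap f : measurable_fun setT f -> (forall z, 0 <= f z)%E ->
  (\int[area]_z f (z.2, z.1) = \int[area]_z f z)%E.
Proof.
move=> mf f0; rewrite [LHS]fubini_tonelli1 ?[RHS]fubini_tonelli2//.
by msr.
Qed.

Lemma ge0_integralZl_area (k : R) f : measurable_fun setT f ->
  (forall z, 0 <= f z)%E -> 0 <= k ->
  (\int[area]_z (k%:E * f z) = k%:E * \int[area]_z f z)%E.
Proof. by move=> mf f0 k0; rewrite ge0_integralZl. Qed.

(** A matrix with nonzero determinant is a product of two shears when its
    upper left entry is nonzero, and of two shears and a swap otherwise. *)
Lemma integral_plane_linear (p q r s : R) f : p * s - q * r != 0 ->
  measurable_fun setT f -> (forall z, 0 <= f z)%E ->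
  (`|p * s - q * r|%:E *
     \int[area]_z f (p * z.1 + q * z.2, r * z.1 + s * z.2)%R =
   \int[area]_z f z)%E.
Proof.
have shear (c a : R) (g : T2 -> \bar R) : c != 0 -> measurable_fun setT g ->
    (forall z, 0 <= g z)%E ->
    (`|c|%:E * \int[area]_z g (z.1, c * z.2 + a * z.1)%R =
     \int[area]_z g z)%E.
  move=> c0 mg g0.
  rewrite -ge0_integralZl_area//; last by msr.
  rewrite -[RHS](integral_shear mu (c := cst c) (a := fun x => a * x))//.
  exact: measurable_funM.
have shear' (c a : R) (g : T2 -> \bar R) : c != 0 -> measurable_fun setT g ->
    (forall z, 0 <= g z)%E ->
    (`|c|%:E * \int[area]_z g (c * z.1 + a * z.2, z.2)%R =
     \int[area]_z g z)%E.
  move=> c0 mg g0; rewrite -[RHS]integral_swap//.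
  rewrite -(shear c a (fun z => g (z.2, z.1)))//; last by msr.
  by rewrite -[in RHS]integral_swap//=; msr.
move=> + mf f0; have [->|p0] := eqVneq p 0.
  rewrite mul0r sub0r oppr_eq0 mulf_eq0 negb_or => /andP[q0 r0].
  rewrite -[RHS]integral_swap// -(shear q 0 (fun z => f (z.2, z.1)))//; last by msr.
  rewrite -(shear' r s (fun z => f (q * z.2 + 0 * z.1, z.1)%R))//; last by msr.
  rewrite muleA -EFinM normrN normrM; congr (_ * _)%E.
  by apply: eq_integral => z _; congr f; congr pair => /=; ring.
move=> d0; have dp0 : (p * s - q * r) / p != 0.
  by rewrite mulf_neq0// invr_eq0.
rewrite -[RHS](shear ((p * s - q * r) / p) (r / p))//.
rewrite -(shear' p q
  (fun z => f (z.1, (p * s - q * r) / p * z.2 + r / p * z.1)%R))//; last by msr.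
rewrite muleA -EFinM -normrM; congr (`| _ |%:E * _)%E; first by field.
by apply: eq_integral => z _; congr f; congr pair => /=; field.
Qed.

(** A line through the origin is negligible: almost all sections of the plane
    parallel to a coordinate axis meet it in a single point. *)
Lemma eq_integral_off_line (p q : R) f g : (p != 0) || (q != 0) ->
  measurable_fun setT f -> measurable_fun setT g ->
  (forall z, 0 <= f z)%E -> (forall z, 0 <= g z)%E ->
  (forall z, p * z.2 - q * z.1 != 0 -> f z = g z) ->
  (\int[area]_z f z = \int[area]_z g z)%E.
Proof.
wlog p0 : p q f g / p != 0 => [wlog_p pq|_] mf mg f0 g0 fg.
  have [p0|p0] := eqVneq p 0; last exact: (wlog_p p q).
  move: pq; rewrite p0 eqxx /= => q0; rewrite -integral_swap// -[RHS]integral_swap//.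
  apply: (wlog_p q p) => //=; rewrite ?q0//; [by msr|by msr|].
  by move=> z qz; apply: fg => /=; rewrite -oppr_eq0 opprB.
rewrite (integral_area mf f0) (integral_area mg g0); apply: eq_integral => x _.
apply: (@eq_integral_except1 _ (q * x / p)).
- exact: measurableT_comp.
- exact: measurableT_comp.
move=> y yx; apply: fg => /=; rewrite subr_eq0.
by apply: contra yx => /eqP <-; apply/eqP; field.
Qed.

End plane.

Ltac nonneg := rewrite -?EFinM ?lee_fin;
  repeat first [exact: sqr_ge0 | by [] | apply: mulr_ge0 | apply: addr_ge0].

(** * Pairs of vectors in a common plane *)
Section pencil.
Context {R : realType}.
Local Notation T1 := (measurableTypeR R).
Local Notation T2 := (T1 * T1)%type.
Local Notation mu := (@lebesgue_measure R).

Definition wedge (p q : T2) : R := p.1 * q.2 - p.2 * q.1.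

(** The point above p of the plane orthogonal to (c, 1). *)
Definition perp_lift (c p : T2) : E3 R := (p, - (c.1 * p.1 + c.2 * p.2)).

Lemma integral_lebesgue3 (f : E3 R -> \bar R) :
  measurable_fun setT f -> (forall x, 0 <= f x)%E ->
  (\int[lebesgue3]_x f x = \int[area]_p \int[mu]_t f (p, t))%E.
Proof.
move=> mf f0.
exact: (integral_sf_product area mu mf f0).
Qed.

Lemma measurable_wedge d (T : measurableType d) (f g : T -> T2) :
  measurable_fun setT f -> measurable_fun setT g ->
  measurable_fun setT (fun x => wedge (f x) (g x)).
Proof. by move=> mf mg; rewrite /wedge; msr. Qed.

Lemma measurable_perp_lift d (T : measurableType d) (f g : T -> T2) :
  measurable_fun setT f -> measurable_fun setT g ->
  measurable_fun setT (fun x => perp_lift (f x) (g x)).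
Proof. by move=> mf mg; rewrite /perp_lift; msr. Qed.

(** For p and q with nonzero [wedge p q], the map
    c |-> (- <c, p>, - <c, q>) is linear and invertible with determinant
    [wedge p q].  Hence almost every pair of vectors lies in exactly one
    of the planes orthogonal to (c, 1), and the volume of pairs disintegrates
    along these planes. *)
Lemma integral_pencil (G : E3 R * E3 R -> \bar R) :
  measurable_fun setT G -> (forall z, 0 <= G z)%E ->
  (\int[lebesgue3]_x \int[lebesgue3]_y G (x, y) =
   \int[area]_c \int[area]_p \int[area]_q
      (`|wedge p q|%:E * G (perp_lift c p, perp_lift c q)))%E.
Proof.
move=> mG G0.
pose H (c p q : T2) : \bar R := (`|wedge p q|%:E * G (perp_lift c p, perp_lift c q))%E.
have H0 c p q : (0 <= H c p q)%E by exact: mule_ge0.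
have mH d (T : measurableType d) (f g h : T -> T2) : measurable_fun setT f ->
    measurable_fun setT g -> measurable_fun setT h ->
    measurable_fun setT (fun x => H (f x) (g x) (h x)).
  move=> mf mg mh; rewrite /H.
  apply: emeasurable_funM.
    by apply/measurable_EFinP; apply: (measurableT_comp (@normr_measurable _ _));
       exact: measurable_wedge.
  by apply: (measurableT_comp mG); apply: measurable_fun_pair;
     exact: measurable_perp_lift.
pose K (p q z : T2) := G ((p, z.1), (q, z.2)).
have mK d (T : measurableType d) (f g h : T -> T2) : measurable_fun setT f ->
    measurable_fun setT g -> measurable_fun setT h ->
    measurable_fun setT (fun x => K (f x) (g x) (h x)).
  by move=> mf mg mh; rewrite /K; msr.
have K0 p q z : (0 <= K p q z)%E by exact: G0.
transitivity (\int[area]_p \int[area]_q \int[area]_z K p q z)%E.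
  rewrite integral_lebesgue3; last 2 first.
  - apply: (measurable_fun_integral (sf_product area mu)
      (f := fun x y => G (x, y))) => //.
    by apply: eq_measurable_fun mG => -[].
  - by move=> x; apply: integral_ge0.
  apply: eq_integral => p _.
  transitivity (\int[mu]_t \int[area]_q \int[mu]_s G (p, t, (q, s)))%E.
    apply: eq_integral => t _; rewrite integral_lebesgue3//.
    exact: measurableT_comp.
  rewrite (fubini_tonelli (m1 := mu) (m2 := area)
    (fun w : T1 * T2 => \int[mu]_t G (p, w.1, (w.2, t)))%E)/=; last 2 first.
  - apply: (measurable_fun_integral mu
      (f := fun (w : T1 * T2) t => G (p, w.1, (w.2, t)))) => //.
    by msr.
  - by move=> w; apply: integral_ge0.
  apply: eq_integral => q _.
  rewrite integral_area//; first by apply: (mK _ _ (cst p) (cst q)).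
transitivity (\int[area]_p \int[area]_q \int[area]_c H c p q)%E; last first.
  transitivity (\int[area]_p \int[area]_c \int[area]_q H c p q)%E.
    apply: eq_integral => p _.
    apply: (fubini_tonelli (m1 := area) (m2 := area)
      (fun w : T2 * T2 => H w.2 p w.1)) => //.
    exact: (mH _ _ _ (cst p)).
  apply: (fubini_tonelli (m1 := area) (m2 := area)
    (fun w : T2 * T2 => \int[area]_q H w.2 w.1 q)%E).
    apply: (measurable_fun_integral area
      (f := fun (w : T2 * T2) q => H w.2 w.1 q)) => //.
    by apply: mH; msr.
  by move=> w; apply: integral_ge0.
have mKi : measurable_fun setT (fun w : T2 * T2 => \int[area]_z K w.1 w.2 z)%E.
  apply: (measurable_fun_integral area
      (f := fun (w : T2 * T2) q => K w.1 w.2 q)) => //.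
  by apply: mK; msr.
have mHi : measurable_fun setT (fun w : T2 * T2 => \int[area]_c H c w.1 w.2)%E.
  apply: (measurable_fun_integral area
      (f := fun (w : T2 * T2) c => H c w.1 w.2)) => //.
  by apply: mH; msr.
apply: (@eq_integral_off_line _ 0 1).
- by rewrite oner_neq0 orbT.
- apply: (measurable_fun_integral area
    (f := fun p q => \int[area]_z K p q z)%E) => // p q.
  exact: integral_ge0.
- apply: (measurable_fun_integral area
    (f := fun p q => \int[area]_c H c p q)%E) => // p q.
  exact: integral_ge0.
- by move=> p; apply: integral_ge0 => q _; exact: integral_ge0.
- by move=> p; apply: integral_ge0 => q _; exact: integral_ge0.
move=> p; rewrite mul0r mul1r sub0r oppr_eq0 => p0.
apply: (@eq_integral_off_line _ p.1 p.2).
- by rewrite p0.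
- exact: (measurableT_comp mKi (pair1_measurable p)).
- exact: (measurableT_comp mHi (pair1_measurable p)).
- by move=> q; exact: integral_ge0.
- by move=> q; exact: integral_ge0.
move=> q; rewrite -[_ - _]/(wedge p q) => pq0.
have dE : - p.1 * - q.2 - - p.2 * - q.1 = wedge p q by rewrite /wedge; ring.
rewrite -(@integral_plane_linear _ (- p.1) (- p.2) (- q.1) (- q.2)) ?dE//;
  last by apply: (mK _ _ (cst p) (cst q)).
rewrite -ge0_integralZl_area//; last first.
  by apply: (mK _ _ (cst p) (cst q)) => //; msr.
apply: eq_integral => c _; rewrite /H /K/= /perp_lift.
by congr (_ * G ((_, _), (_, _)))%E; ring.
Qed.
End pencil.

(** * Second moments of a planar double sector *)
Section moments.
Context {R : realType}.
Local Notation T1 := (measurableTypeR R).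
Local Notation T2 := (T1 * T1)%type.
Local Notation mu := (@lebesgue_measure R).

Lemma integral_antiderivative (F f : R -> R) (a b : R) : a <= b ->
  (forall x : R, is_derive x 1 F (f x)) -> continuous f ->
  (\int[mu]_(x in `[a, b]) (f x)%:E = (F b - F a)%:E)%E.
Proof.
move=> + dF cf; rewrite le_eqVlt => /predU1P[<-|ab].
  by rewrite set_itv1 integral_set1 subrr.
have cF : continuous F.
  by move=> x; apply/differentiable_continuous/derivable1_diffP; exact: ex_derive.
rewrite (@continuous_FTC2 _ f F)//.
- by apply: continuous_in_subspaceT => x _; exact: cf.
- split.
  + by move=> x _; exact: ex_derive.
  + by apply: cvg_at_right_filter; exact: cF.
  + by apply: cvg_at_left_filter; exact: cF.
- by move=> x _; rewrite derive1E; exact: derive_val.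
Qed.

Lemma integral_sqr_ball (r : R) : 0 <= r ->
  (\int[mu]_t (t ^+ 2 * \1_(`[- r, r]%classic) t)%:E = (2 / 3 * r ^+ 3)%:E)%E.
Proof.
move=> r0.
have dF (x : R) : is_derive x 1 (fun t : R => t ^+ 3 / 3) (x ^+ 2).
  by apply: is_derive_eq; rewrite /GRing.scale/= ?mulr1 !mulr0; field.
transitivity (\int[mu]_(t in `[(- r)%R, r]) (t ^+ 2)%:E)%E.
  rewrite [RHS]integral_mkcond; apply: eq_integral => t _.
  by rewrite patchE indicE; case: ifPn => _; rewrite ?mulr1 ?mulr0.
rewrite (integral_antiderivative _ dF)//; first by congr EFin; field.
  by lra.
exact: exprn_continuous.
Qed.

(* Half the sum and half the difference of atan m and m / (1 + m^2) have
   derivatives 1 / (1 + m^2)^2 and m^2 / (1 + m^2)^2. *)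
Let aminus (m : R) : R := (atan m - m / (1 + m ^+ 2)) / 2.
Let aplus (m : R) : R := (atan m + m / (1 + m ^+ 2)) / 2.

Let sqr1_neq0 (m : R) : 1 + m ^+ 2 != 0.
Proof. by rewrite gt_eqF// ltr_wpDr// sqr_ge0. Qed.

Let is_derive_aplus (m : R) : is_derive m 1 aplus ((1 + m ^+ 2) ^- 2).
Proof.
have d0 := sqr1_neq0 m.
by rewrite /aplus; apply: is_derive_eq; rewrite /GRing.scale/=; field.
Qed.

Let is_derive_aminus (m : R) :
  is_derive m 1 aminus (m ^+ 2 * (1 + m ^+ 2) ^- 2).
Proof.
have d0 := sqr1_neq0 m.
by rewrite /aminus; apply: is_derive_eq; rewrite /GRing.scale/=; field.
Qed.

Let continuous_invsqr : continuous (fun m : R => (1 + m ^+ 2) ^- 2).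
Proof.
move=> m; apply: cvgV; first by rewrite expf_neq0.
apply: (@cvg_comp _ _ _ (fun m : R => 1 + m ^+ 2) (fun x => x ^+ 2)).
  exact: continuous_oneDsqr.
exact: exprn_continuous.
Qed.

Let continuous_sqr_invsqr :
  continuous (fun m : R => m ^+ 2 * (1 + m ^+ 2) ^- 2).
Proof.
move=> m; apply: cvgM; first exact: exprn_continuous.
exact: continuous_invsqr.
Qed.

Let cvgy_aplus : aplus x @[x --> +oo] --> pi / 2 / 2.
Proof.
rewrite /aplus; apply: cvgM; last exact: cvg_cst.
rewrite -[X in _ --> X]addr0; apply: cvgD; first exact: cvgy_atan.
apply: (@squeeze_cvgr _ _ _ _ (cst 0) (fun x => x^-1)).
- near=> x; have x0 : 0 < x by near: x; exact: nbhs_pinfty_gt.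
  rewrite divr_ge0 ?(ltW x0) ?addr_ge0 ?sqr_ge0//=.
  rewrite ler_pdivrMr ?ltr_wpDr ?sqr_ge0// ler_pdivlMl//.
  by rewrite -expr2 lerDr.
- exact: cvg_cst.
- apply/(@gtr0_cvgV0 _ _ (+oo) _ id); last exact: cvg_id.
  exact: nbhs_pinfty_gt.
Unshelve. all: by end_near. Qed.

(** The substitution (x, y) = (m t, t), where m is the slope relative to
    the second axis. *)
Lemma integral_slope (F : T2 -> \bar R) :
  measurable_fun setT F -> (forall z, 0 <= F z)%E ->
  (\int[area]_p F p = \int[mu]_m \int[mu]_t (`|t|%:E * F (m * t, t)%R))%E.
Proof.
move=> mF F0; rewrite [LHS](fubini_tonelli2 _ mF F0) /fubini_G.
transitivity (\int[mu]_t \int[mu]_m (`|t|%:E * F (m * t, t)%R))%E.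
  apply: (@eq_integral_except1 _ 0).
  - exact: (measurable_fun_fubini_tonelli_G F).
  - apply: (@measurable_fun_integral _ _ T1 T1 R mu
      (fun t m : T1 => `|t|%:E * F (m * t, t)%R)%E).
      by msr.
    by move=> t m; rewrite mule_ge0.
  move=> t t0; rewrite -(@integral_affine _ t 0 (fun x => F (x, t)))//; last first.
    exact: measurableT_comp.
  rewrite ge0_integralZl//; last by msr.
  by congr (_ * _)%E; apply: eq_integral => m _; rewrite addr0 mulrC.
apply: (fubini_tonelli (m1 := mu) (m2 := mu)
  (fun z => `|z.1|%:E * F (z.2 * z.1, z.1)%R)%E) => [|z].
  by msr.
by rewrite mule_ge0.
Qed.

(** The density 1 / r on the punctured unit ball.  It stems from writing an
    integral over the sphere, whose integrand is homogeneous of degree one, as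
    an integral over the ball. *)
Definition radial (r : R) : R := \1_(`]0, 1]%classic) r / r.

Definition pnorm (p : T2) : R := Num.sqrt (p.1 ^+ 2 + p.2 ^+ 2).

(** The double sector of half-opening atan T around the second axis. *)
Definition sector (T : R) : set T2 := [set p | `|p.1| <= T * `|p.2|].

Lemma radial_ge0 r : 0 <= radial r.
Proof.
rewrite /radial indicE; case: (boolP (_ \in _)) => r0; last by rewrite mul0r.
by move: r0; rewrite inE/= in_itv/= mul1r invr_ge0 => /andP[/ltW].
Qed.

Lemma measurable_radial d (T : measurableType d) (f : T -> R) :
  measurable_fun setT f -> measurable_fun setT (fun x => radial (f x)).
Proof. by move=> mf; rewrite /radial; msr. Qed.

(** On the line of slope m, the disc cuts out |t| <= 1 / sqrt(1 + m^2) and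
    the integrand in t is a multiple of t^2. *)
Lemma integral_slope_radial (h : R -> R) :
  measurable_fun setT h -> (forall m, 0 <= h m) ->
  (\int[area]_p (p.2 ^+ 2 * h (p.1 / p.2) * radial (pnorm p))%:E =
   \int[mu]_m (2 / 3 * (h m * (1 + m ^+ 2) ^- 2))%:E)%E.
Proof.
move=> mh h0; rewrite integral_slope; last 2 first.
- apply/measurable_EFinP; apply: measurable_funM; first by msr.
  by apply: measurable_radial; rewrite /pnorm; msr.
- move=> p; rewrite lee_fin; apply: mulr_ge0; last exact: radial_ge0.
  by apply: mulr_ge0 => //; exact: sqr_ge0.
apply: eq_integral => m _.
pose N := Num.sqrt (1 + m ^+ 2).
have N2 : N ^+ 2 = 1 + m ^+ 2 by rewrite sqr_sqrtr// addr_ge0// sqr_ge0.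
have N0 : 0 < N by rewrite sqrtr_gt0 ltr_wpDr// sqr_ge0.
transitivity (\int[mu]_t ((h m / N)%:E *
    (t ^+ 2 * \1_(`[- N^-1, N^-1]%classic) t)%:E))%E.
  apply: eq_integral => t _; rewrite -!EFinM; congr EFin => /=.
  have [->|t0] := eqVneq t 0; first by rewrite normr0 !expr0n/= !(mul0r,mulr0).
  have nt : 0 < `|t| by rewrite normr_gt0.
  rewrite mulfK// /pnorm/=.
  have -> : (m * t) ^+ 2 + t ^+ 2 = (N * `|t|) ^+ 2.
    by rewrite [RHS]exprMn N2 -normrX ger0_norm ?sqr_ge0//; ring.
  have -> : Num.sqrt ((N * `|t|) ^+ 2) = N * `|t|.
    by rewrite sqrtr_sqr ger0_norm// mulr_ge0// ltW.
    have -> : radial (N * `|t|) =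
            \1_(`[- N^-1, N^-1]%classic) t / (N * `|t|).
    rewrite /radial !indicE; congr ((nat_of_bool _)%:R / _).
    apply/idP/idP; rewrite !inE/= !in_itv/=.
      move=> /andP[_]; rewrite mulrC -ler_pdivlMr// mul1r.
      by rewrite ler_norml.
    move=> tN; rewrite mulr_gt0//= mulrC -ler_pdivlMr// mul1r ler_norml//.
  by field; rewrite !gt_eqF.
rewrite ge0_integralZl//; last 3 first.
- by apply/measurable_EFinP; apply: measurable_funM => //; msr.
- by move=> t _; rewrite lee_fin mulr_ge0 ?sqr_ge0.
- by rewrite lee_fin divr_ge0// ltW.
rewrite integral_sqr_ball ?invr_ge0 ?(ltW N0)//.
by rewrite -EFinM -N2; congr EFin; field; rewrite gt_eqF.
Qed.

Let measurable_invsqr : measurable_fun setT (fun m : R => (1 + m ^+ 2) ^- 2).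
Proof. exact: continuous_measurable_fun continuous_invsqr. Qed.

Let measurable_sqr_invsqr :
  measurable_fun setT (fun m : R => m ^+ 2 * (1 + m ^+ 2) ^- 2).
Proof. exact: continuous_measurable_fun continuous_sqr_invsqr. Qed.

(** The whole plane is the limit of sectors with T -> +oo, where
    T / (1 + T^2) vanishes and atan T tends to pi / 2. *)
Lemma plane_moment2 :
  (\int[area]_p (p.2 ^+ 2 * radial (pnorm p))%:E = (pi / 3 : R)%:E)%E.
Proof.
transitivity (\int[area]_p (p.2 ^+ 2 * cst 1 (p.1 / p.2) * radial (pnorm p))%:E)%E.
  by apply: eq_integral => p _; rewrite /= mulr1.
rewrite integral_slope_radial//.
under eq_integral do rewrite mul1r EFinM.
rewrite ge0_integralZl//; last 2 first.
- exact/measurable_EFinP.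
- by move=> x _; rewrite lee_fin invr_ge0 sqr_ge0.
rewrite (@ge0_symfun_integralT _ (fun m : R => (1 + m ^+ 2) ^- 2)); last 3 first.
- by move=> x; rewrite invr_ge0 sqr_ge0.
- exact: continuous_invsqr.
- by move=> x /=; rewrite sqrrN.
rewrite -set_itvcy (ge0_continuous_FTC2y _ _ cvgy_aplus)//.
- by rewrite /aplus atan0 mul0r addr0 mul0r -EFinB -!EFinM; congr EFin; field.
- by move=> x _; rewrite invr_ge0 sqr_ge0.
- exact: continuous_subspaceT.
- apply: cvg_at_right_filter.
  by apply/differentiable_continuous/derivable1_diffP; exact: ex_derive.
- by move=> x _; rewrite derive1E; exact: derive_val.
Qed.

Lemma plane_moment1 :
  (\int[area]_p (p.1 ^+ 2 * radial (pnorm p))%:E = (pi / 3 : R)%:E)%E.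
Proof.
rewrite -plane_moment2 -integral_swap//=.
- by apply: eq_integral => p _; rewrite /pnorm/= addrC.
- apply/measurable_EFinP; apply: measurable_funM; first by msr.
  by apply: measurable_radial; rewrite /pnorm; msr.
- by move=> p; rewrite lee_fin; apply: mulr_ge0; [exact: sqr_ge0|exact: radial_ge0].
Qed.

Let integral_sector (T : R) (h F : R -> R) : 0 <= T ->
  measurable_fun setT h -> (forall m, 0 <= h m) ->
  (forall m : R, is_derive m 1 F (h m * (1 + m ^+ 2) ^- 2)) ->
  continuous (fun m => h m * (1 + m ^+ 2) ^- 2) ->
  (\int[area]_p
     (p.2 ^+ 2 * h (p.1 / p.2) * (\1_(sector T) p * radial (pnorm p)))%:E =
   (2 / 3 * (F T - F (- T)))%:E)%E.
Proof.
move=> T0 mh h0 dF cf.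
transitivity (\int[area]_p (p.2 ^+ 2 *
    (h (p.1 / p.2) * \1_(`[- T, T]%classic) (p.1 / p.2)) * radial (pnorm p))%:E)%E.
  apply: eq_integral => p _; congr EFin; rewrite !mulrA.
  have [->|p0] := eqVneq p.2 0; first by rewrite expr0n/= !mul0r.
  congr (_ * _ * _); congr (_ * _); rewrite !indicE; congr (nat_of_bool _)%:R.
  apply/idP/idP; rewrite !inE /sector/= in_itv/= -ler_norml normrM normfV.
    by rewrite ler_pdivrMr ?normr_gt0.
  by rewrite ler_pdivrMr ?normr_gt0.
rewrite (@integral_slope_radial (fun m => h m * \1_(`[- T, T]%classic) m)); last 2 first.
- by apply: measurable_funM; [|exact: measurable_indic].
- by move=> m; rewrite mulr_ge0.
rewrite EFinM -(integral_antiderivative _ dF)//; last by lra.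
rewrite [X in (_ * X)%E]integral_mkcond -ge0_integralZl//.
- apply: eq_integral => m _; rewrite patchE indicE.
  case: ifPn => _; first by rewrite mulr1 EFinM.
  by rewrite mulr0 mul0r mulr0 -[point]/(0%E) mule0.
- apply/(measurable_restrict _ (measurable_itv _) measurableT).
  by apply/measurable_EFinP/measurable_funTS; exact: continuous_measurable_fun.
- move=> m _; apply: erestrict_ge0 => {}m _.
  by rewrite lee_fin mulr_ge0// invr_ge0 sqr_ge0.
Qed.

Lemma sector_moment2 (T : R) : 0 <= T ->
  (\int[area]_p (p.2 ^+ 2 * (\1_(sector T) p * radial (pnorm p)))%:E =
   (2 / 3 * (atan T + T / (1 + T ^+ 2)))%:E)%E.
Proof.
move=> T0.
have [dF cf] : (forall m : R, is_derive m 1 aplus (cst 1 m * (1 + m ^+ 2) ^- 2)) /\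
    continuous (fun m : R => cst 1 m * (1 + m ^+ 2) ^- 2).
  rewrite (_ : (fun m => _) = fun m : R => (1 + m ^+ 2) ^- 2); last first.
    by apply/funext => m /=; rewrite mul1r.
  by split=> // m; rewrite mul1r.
have := integral_sector T0 (measurable_cst _) (fun=> ler01) dF cf.
under eq_integral do rewrite mulr1.
move=> ->; rewrite /aplus atanN sqrrN; congr EFin.
by have d0 := sqr1_neq0 T; field.
Qed.

Lemma sector_moment1 (T : R) : 0 <= T ->
  (\int[area]_p (p.1 ^+ 2 * (\1_(sector T) p * radial (pnorm p)))%:E =
   (2 / 3 * (atan T - T / (1 + T ^+ 2)))%:E)%E.
Proof.
move=> T0.
transitivity (\int[area]_p (p.2 ^+ 2 * (p.1 / p.2) ^+ 2 *
    (\1_(sector T) p * radial (pnorm p)))%:E)%E.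
  apply: eq_integral => p _; congr EFin.
  have [p0|p0] := eqVneq p.2 0; last by congr (_ * _); field.
  rewrite p0 expr0n/= !mul0r indicE; case: (boolP (_ \in _)) => [|_].
    rewrite inE /sector/= p0 normr0 mulr0 normr_le0 => /eqP ->.
    by rewrite expr0n/= mul0r.
  by rewrite mul0r mulr0.
rewrite (integral_sector (h := fun m => m ^+ 2) T0 _ _ is_derive_aminus
  continuous_sqr_invsqr)//.
- rewrite /aminus atanN sqrrN; congr EFin.
  by have d0 := sqr1_neq0 T; field.
- by move=> m; exact: sqr_ge0.
Qed.

(** The reflection q.2 |-> - q.2 leaves k unchanged and turns
    (p.1 q.2 - p.2 q.1)^2 into (p.1 q.2 + p.2 q.1)^2.  Averaging the two
    integrals removes the cross term without ever integrating a function of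
    varying sign. *)
Lemma integral_wedge_sqr (k : T2 -> R) (a b : R) :
  measurable_fun setT k -> (forall p, 0 <= k p) ->
  (forall x y, k (x, - y) = k (x, y)) ->
  (\int[area]_p (p.1 ^+ 2 * k p)%:E = a%:E)%E ->
  (\int[area]_p (p.2 ^+ 2 * k p)%:E = b%:E)%E ->
  (\int[area]_p \int[area]_q (wedge p q ^+ 2 * (k p * k q))%:E =
   (2 * a * b)%:E)%E.
Proof.
move=> mk k0 kN Ia Ib.
have inner (p : T2) : (\int[area]_q (wedge p q ^+ 2 * (k p * k q))%:E =
    (b * (p.1 ^+ 2 * k p) + a * (p.2 ^+ 2 * k p))%:E)%E.
  set I := integral _ _ _.
  have I_refl : (I =
      \int[area]_q ((p.1 * q.2 + p.2 * q.1) ^+ 2 * (k p * k q))%:E)%E.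
    pose f (q : T2) : \bar R := (wedge p q ^+ 2 * (k p * k q))%:E.
    have mf : measurable_fun setT f.
      rewrite /f; apply/measurable_EFinP; apply: measurable_funM; last by msr.
      by apply: measurable_funX; apply: (measurable_wedge (f := cst p)).
    have f0 q : (0 <= f q)%E by nonneg.
    have d0 : (1 : R) * (-1) - 0 * 0 != 0.
      by rewrite mul1r mul0r subr0 oppr_eq0 oner_neq0.
    rewrite /I -[LHS](integral_plane_linear d0 mf f0).
    rewrite mul1r mul0r subr0 normrN normr1 mul1e.
    apply: eq_integral => -[x y] _; rewrite /f /wedge/=; congr EFin.
    rewrite !(mul0r, mul1r, addr0, add0r, mulN1r) kN; congr (_ * _); ring.
  have II : (I + I = (2 * (b * (p.1 ^+ 2 * k p) + a * (p.2 ^+ 2 * k p)))%:E)%E.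
    rewrite {2}I_refl /I -ge0_integralD//; last 4 first.
    - by move=> q _; nonneg.
    - by rewrite /wedge; msr.
    - by move=> q _; nonneg.
    - by msr.
    transitivity (\int[area]_q ((2 * (p.1 ^+ 2 * k p))%:E * (q.2 ^+ 2 * k q)%:E +
       (2 * (p.2 ^+ 2 * k p))%:E * (q.1 ^+ 2 * k q)%:E))%E.
      apply: eq_integral => q _; rewrite -!EFinM -!EFinD; congr EFin.
      by rewrite /wedge; ring.
    rewrite ge0_integralD//; last 4 first.
    - by move=> q _; nonneg.
    - by msr.
    - by move=> q _; nonneg.
    - by msr.
    rewrite !ge0_integralZl_area//; last first.
    - by nonneg.
    - by move=> q; nonneg.
    - by msr.
    - by nonneg.
    - by move=> q; nonneg.
    - by msr.
    by rewrite Ia Ib -!EFinM -!EFinD; congr EFin; ring.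
  move: II; case: (I) => [r /=|//|//].
  rewrite -EFinD => -[] rr; congr EFin; lra.
under eq_integral do rewrite inner.
have a0 : 0 <= a.
  by rewrite -lee_fin -Ia integral_ge0// => p _; nonneg.
have b0 : 0 <= b.
  by rewrite -lee_fin -Ib integral_ge0// => p _; nonneg.
under eq_integral do rewrite EFinD EFinM [X in (_ + X)%E]EFinM.
rewrite ge0_integralD//; last 4 first.
- by move=> q _; nonneg.
- by msr.
- by move=> q _; nonneg.
- by msr.
rewrite !ge0_integralZl_area//; last first.
- by move=> q; nonneg.
- by msr.
- by move=> q; nonneg.
- by msr.
by rewrite Ia Ib -!EFinM -!EFinD; congr EFin; ring.
Qed.

End moments.

(** * Borel sets of three-space *)
Section borel_space.
Context {R : realType}.
Local Notation T1 := (measurableTypeR R).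
Local Notation T2 := (T1 * T1)%type.
Local Notation mu := (@lebesgue_measure R).

(** The sigma-algebra of the product contains the boxes with rational centre,
    and an open set is the countable union of those of radius 1 / (n + 1) that
    it contains. *)
Lemma open_measurable_E3 (U : set (E3 R)) : open U -> measurable U.
Proof.
move=> oU.
pose rad (n : nat) : R := n.+1%:R^-1.
pose box (i : rat * rat * rat * nat) : set (E3 R) :=
  (ball (ratr i.1.1.1 : R) (rad i.2) `*` ball (ratr i.1.1.2 : R) (rad i.2)) `*`
  ball (ratr i.1.2 : R) (rad i.2).
rewrite (_ : U = \bigcup_(i in [set i | box i `<=` U]) box i); last first.
  apply/seteqP; split=> [x Ux|x [i /= iU]]; last exact: iU.
  have /nbhs_ballP[e /= e0 eU] : nbhs x U by exact: open_nbhs_nbhs.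
  have [n ne] : exists n, rad n < e / 2.
    have [n _ /(_ n (leqnn n))] :=
      near_infty_natSinv_lt (PosNum (divr_gt0 e0 (@ltr0Sn R 1))).
    by exists n.
  have n0 : 0 < rad n by rewrite invr_gt0.
  have approx (y : R) : exists q : rat, `|ratr q - y| < rad n.
    have yy : y - rad n < y + rad n by lra.
    have [q] := rat_in_itvoo yy; rewrite in_itv/= => /andP[q1 q2].
    by exists q; rewrite ltr_norml; lra.
  have [a ax] := approx x.1.1; have [b bx] := approx x.1.2.
  have [c cx] := approx x.2.
  exists (a, b, c, n); last by [].
  move=> y /= -[[/= ya yb] yc]; apply: eU.
  have tri (q z w : R) : `|q - z| < rad n -> `|q - w| < rad n -> `|z - w| < e.
    move=> qz qw; rewrite (_ : z - w = (z - q) + (q - w)); last by ring.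
    rewrite (le_lt_trans (ler_normD _ _))// [`|z - q|]distrC.
    by rewrite (lt_trans (ltrD qz qw))//; lra.
  by split; first split; rewrite /ball/=; apply: tri; eassumption.
rewrite bigcup_mkcond; apply: countable_bigcupT_measurable => // i.
case: ifPn => _ //.
by apply: measurableX; [apply: measurableX|]; exact: measurable_ball.
Qed.

Lemma closed_measurable_E3 (F : set (E3 R)) : closed F -> measurable F.
Proof.
move=> cF; rewrite -[F]setCK; apply: measurableC; apply: open_measurable_E3.
exact: closed_openC.
Qed.

Lemma measurable_enorm d (T : measurableType d) (f : T -> E3 R) :
  measurable_fun setT f -> measurable_fun setT (fun x => enorm (f x)).
Proof. by move=> mf; rewrite /enorm /dot; msr. Qed.

Lemma measurable_dot d (T : measurableType d) (f g : T -> E3 R) :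
  measurable_fun setT f -> measurable_fun setT g ->
  measurable_fun setT (fun x => dot (f x) (g x)).
Proof. by move=> mf mg; rewrite /dot; msr. Qed.

Lemma measurable_scale3 d (T : measurableType d) (c : T -> R) (f : T -> E3 R) :
  measurable_fun setT c -> measurable_fun setT f ->
  measurable_fun setT (fun x => c x *: f x : E3 R).
Proof.
move=> mc mf.
rewrite (_ : (fun x => _) =
  fun x => ((c x * (f x).1.1, c x * (f x).1.2), c x * (f x).2)) //.
by msr.
Qed.

Lemma measurable_oppE3 d (T : measurableType d) (f : T -> E3 R) :
  measurable_fun setT f -> measurable_fun setT (fun x => - f x : E3 R).
Proof.
move=> mf; rewrite (_ : (fun x => - f x) =
  fun x => ((- (f x).1.1, - (f x).1.2), - (f x).2)) //.
by msr.
Qed.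
End borel_space.

(** * Surface measure in an affine chart *)
Section sphere.
Context {R : realType}.
Local Notation T1 := (measurableTypeR R).
Local Notation T2 := (T1 * T1)%type.
Local Notation mu := (@lebesgue_measure R).
Implicit Types x y u v w : E3 R.

Lemma dot_ge0 x : 0 <= dot x x.
Proof. by rewrite /dot -!expr2 !addr_ge0 ?sqr_ge0. Qed.

Lemma enorm_ge0 x : 0 <= enorm x. Proof. exact: sqrtr_ge0. Qed.

Lemma enorm_sqr x : enorm x ^+ 2 = dot x x.
Proof. by rewrite sqr_sqrtr// dot_ge0. Qed.

Lemma dotC x y : dot x y = dot y x.
Proof. by rewrite /dot; ring. Qed.

Lemma dotZl (t : R) x y : dot (t *: x) y = t * dot x y.
Proof. by rewrite /dot/= /GRing.scale/=; ring. Qed.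

Lemma dotDl x y z : dot (x + y) z = dot x z + dot y z.
Proof. by rewrite /dot/=; ring. Qed.

Lemma dotZr (t : R) x y : dot x (t *: y) = t * dot x y.
Proof. by rewrite dotC dotZl dotC. Qed.

Lemma dotDr x y z : dot z (x + y) = dot z x + dot z y.
Proof. by rewrite dotC dotDl ![dot z _]dotC. Qed.

Lemma enormZ (t : R) x : enorm (t *: x) = `|t| * enorm x.
Proof.
by rewrite /enorm dotZl dotZr mulrA sqrtrM -?expr2 ?sqr_ge0// sqrtr_sqr.
Qed.

Lemma enorm_gt0 x : (0 < enorm x) = (x != 0).
Proof.
rewrite sqrtr_gt0 lt_neqAle dot_ge0 andbT eq_sym; congr (~~ _).
apply/eqP/eqP => [|->]; last by rewrite /dot/=; ring.
case: x => -[a b] c; rewrite /dot/= -!expr2 => /eqP.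
rewrite !paddr_eq0 ?addr_ge0 ?sqr_ge0// !sqrf_eq0.
by move=> /andP[/andP[/eqP -> /eqP ->] /eqP ->].
Qed.

Definition normalize x : E3 R := (enorm x)^-1 *: x.

Definition punctured_ball : set (E3 R) := [set x | 0 < enorm x <= 1].

Lemma enorm_normalize x : x != 0 -> enorm (normalize x) = 1.
Proof.
rewrite -enorm_gt0 => x0.
by rewrite enormZ ger0_norm ?invr_ge0 ?enorm_ge0// mulVf// gt_eqF.
Qed.

Lemma measurable_normalize d (T : measurableType d) (f : T -> E3 R) :
  measurable_fun setT f -> measurable_fun setT (fun z => normalize (f z)).
Proof.
move=> mf; apply: measurable_scale3 => //.
by apply: measurable_fun_inv; exact: measurable_enorm.
Qed.

Lemma measurable_punctured_ball : measurable punctured_ball.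
Proof.
rewrite (_ : punctured_ball = (@enorm R) @^-1` `]0, 1]%classic).
  by rewrite -[X in measurable X]setTI; apply: (measurable_enorm (f := id)).
by apply/seteqP; split=> x /=; rewrite in_itv.
Qed.

(* Surface measure is three times the image of the volume of the punctured
   unit ball under the radial projection. *)
Let ball_measure : {measure set (E3 R) -> \bar R} :=
  mrestr lebesgue3 measurable_punctured_ball.

Let image_measure : {measure set (E3 R) -> \bar R} :=
  measure_function_pushforward__canonical__measure_function_Measure
    ball_measure (measurable_normalize (@measurable_id _ (E3 R) setT)).

Let surfaceE (A : set (E3 R)) : surface A = mscale 3%:R%:nng image_measure A.
Proof.
rewrite /surface /mscale/=; congr (_ * _)%E.
rewrite /pushforward /mrestr; apply: (congr1 lebesgue3).
apply/seteqP; split=> [x [t /=]|x [/= Ax /andP[x0 x1]]].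
  rewrite in_itv/= => /andP[t0 t1] [u [Au su]] <-.
  have tE : enorm (t *: u) = t by rewrite enormZ su mulr1 gtr0_norm.
  split; last by rewrite /punctured_ball/= tE t0.
  by rewrite /= /normalize tE scalerA mulVf ?gt_eqF// scale1r.
exists (enorm x); first by rewrite /= in_itv/= x0.
exists (normalize x); last first.
  by rewrite /normalize scalerA mulfV ?gt_eqF// scale1r.
by split=> //; rewrite /sphere/= enorm_normalize// -enorm_gt0.
Qed.

Lemma integral_surface (f : E3 R -> \bar R) :
  measurable_fun setT f -> (forall x, 0 <= f x)%E ->
  (\int[surface]_u f u =
   3%:E * \int[lebesgue3]_x ((\1_punctured_ball x)%:E * f (normalize x)))%E.
Proof.
move=> mf f0.
rewrite (eq_measure_integral (mscale 3%:R%:nng image_measure)); last first.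
  by move=> A _ _; exact: surfaceE.
rewrite ge0_integral_mscale; [|exact: measurableT|exact: mf|by move=> *; exact: f0].
suff -> : (\int[image_measure]_x f x =
    \int[lebesgue3]_x ((\1_punctured_ball x)%:E * f (normalize x)))%E; first reflexivity.
rewrite ge0_integral_pushforward; [|exact: (measurable_normalize (f := id))
  |exact: measurableT|exact: mf|by move=> *; exact: f0].
rewrite preimage_setT.
have mB := measurable_punctured_ball.
have mg : measurable_fun setT (f \o normalize).
  by apply: measurableT_comp => //; exact: measurable_normalize.
rewrite -[in LHS](setUv punctured_ball) ge0_integral_setU; last 5 first.
- exact: mB.
- exact: measurableC.
- by rewrite setUv.
- by move=> x _; exact: f0.
- exact/disj_setPCl.
rewrite [X in (_ + X)%E](_ : _ = 0%E) ?adde0; last first.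
  rewrite (eq_measure_integral (@mzero _ (E3 R) R)) ?integral_measure_zero//.
  move=> A mA AB; rewrite /ball_measure/= /mrestr /mzero.
  by rewrite (_ : A `&` _ = set0) ?measure0//; apply/seteqP; split=> x // [/AB].
rewrite (eq_measure_integral lebesgue3); last first.
  move=> A mA AB; rewrite /ball_measure/= /mrestr.
  by apply: (congr1 lebesgue3); exact/setIidl.
rewrite [LHS]integral_mkcond. apply: eq_integral => x _.
rewrite patchE indicE; case: ifPn => _; first by rewrite mul1e.
by rewrite mul0e.
Qed.

Definition ray (c : T2) (t : T1) : E3 R := ((t * c.1, t * c.2), t).

(** At height t, the horizontal section is parametrized by t c, which scales
    areas by t^2. *)
Lemma integral_ray (f : E3 R -> \bar R) :
  measurable_fun setT f -> (forall x, 0 <= f x)%E ->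
  (\int[lebesgue3]_x f x = \int[area]_c \int[mu]_t ((t ^+ 2)%:E * f (ray c t)))%E.
Proof.
move=> mf f0; rewrite (integral_lebesgue3 mf f0).
rewrite (fubini_tonelli (m1 := area) (m2 := mu) f)//=.
transitivity (\int[mu]_t \int[area]_c ((t ^+ 2)%:E * f (ray c t)))%E.
  apply: (@eq_integral_except1 _ 0).
  - exact: (measurable_fun_fubini_tonelli_G (m1 := area) f).
  - apply: (@measurable_fun_integral _ _ T1 T2 R area
      (fun t c => (t ^+ 2)%:E * f (ray c t))%E).
      by rewrite /ray; msr.
    by move=> t c; rewrite mule_ge0// lee_fin sqr_ge0.
  move=> t t0.
  have d0 : t * t - 0 * 0 != 0 by rewrite mul0r subr0 mulf_neq0.
  rewrite -(integral_plane_linear d0 (f := fun p => f (p, t)))//; last first.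
    exact: measurableT_comp.
  rewrite mul0r subr0 -expr2 ger0_norm ?sqr_ge0//.
  rewrite -ge0_integralZl_area ?sqr_ge0//; last by msr.
  by apply: eq_integral => c _; rewrite /ray !mul0r addr0 add0r.
apply: (fubini_tonelli (m1 := mu) (m2 := area)
  (fun z : T1 * T2 => (z.1 ^+ 2)%:E * f (ray z.2 z.1))%E) => [|z].
  by rewrite /ray; msr.
by rewrite mule_ge0// lee_fin sqr_ge0.
Qed.

Definition chart (c : T2) : E3 R := (c, 1).

(** The secant of the angle between (c, 1) and the vertical axis. *)
Definition slant (c : T2) : R := enorm (chart c).

Lemma chart_neq0 c : chart c != 0.
Proof.
by apply/eqP => /(congr1 snd)/=/eqP; rewrite oner_eq0.
Qed.

Lemma slant_gt0 c : 0 < slant c.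
Proof. by rewrite /slant enorm_gt0 chart_neq0. Qed.

Lemma measurable_chart d (T : measurableType d) (f : T -> T2) :
  measurable_fun setT f -> measurable_fun setT (fun z => chart (f z)).
Proof. by move=> mf; rewrite /chart; msr. Qed.

Lemma rayE c t : ray c t = t *: chart c.
Proof. by rewrite /ray; congr pair; rewrite /= [RHS]mulr1. Qed.

Lemma normalizeZ (t : R) x : t != 0 ->
  normalize (t *: x) = normalize x \/ normalize (t *: x) = - normalize x.
Proof.
move=> t0; rewrite /normalize enormZ scalerA invfM mulrAC.
have [tn|tp] := ltP t 0.
  right; rewrite ltr0_norm// invrN mulNr mulVf// mulN1r.
  by rewrite scaleNr.
by left; rewrite ger0_norm// mulVf// mul1r.
Qed.

(** The open hemispheres above and below the horizontal plane project centrally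
    onto the plane of height one; for an even function they contribute equally,
    whence the factor 2.  The inner integral of t^2 over |t| <= 1 / slant
    produces the Jacobian slant^-3. *)
Lemma integral_surface_chart (f : E3 R -> \bar R) :
  measurable_fun setT f -> (forall x, 0 <= f x)%E -> (forall x, f (- x) = f x) ->
  (\int[surface]_u f u =
   \int[area]_c ((2 * slant c ^- 3)%:E * f (normalize (chart c))))%E.
Proof.
move=> mf f0 fN; rewrite integral_surface// integral_ray; last 2 first.
- apply: emeasurable_funM; last first.
    by apply: (measurableT_comp mf); exact: measurable_normalize.
  by apply/measurable_EFinP; apply: measurable_indic;
    exact: measurable_punctured_ball.
- by move=> x; rewrite mule_ge0.
have mslant : measurable_fun setT slant.
  by apply: measurable_enorm; exact: (measurable_chart (f := id)).
rewrite -ge0_integralZl//; last 2 first.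
- apply: (@measurable_fun_integral _ _ T2 T1 R mu (fun c t =>
    (t ^+ 2)%:E * ((\1_punctured_ball (ray c t))%:E * f (normalize (ray c t))))%E).
    have mray : measurable_fun setT (fun z : T2 * T1 => ray z.1 z.2).
      by rewrite /ray; msr.
    apply: emeasurable_funM; first by msr.
    apply: emeasurable_funM.
      apply/measurable_EFinP; apply: measurable_fun_inset => //.
      exact: measurable_punctured_ball.
    by apply: (measurableT_comp mf); exact: measurable_normalize.
  by move=> c t; rewrite !mule_ge0// lee_fin sqr_ge0.
- by move=> c _; apply: integral_ge0 => t _; rewrite !mule_ge0// lee_fin sqr_ge0.
apply: eq_integral => c _.
have s0 := slant_gt0 c.
transitivity (3%:E * \int[mu]_t
    (f (normalize (chart c)) *
     (t ^+ 2 * \1_(`[- (slant c)^-1, (slant c)^-1]%classic) t)%:E))%E.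
  congr (_ * _)%E; apply: eq_integral => t _.
  rewrite rayE; have [->|t0] := eqVneq t 0.
    by rewrite expr0n/= !mul0r mul0e mule0.
  rewrite muleA [RHS]muleC; congr (_ * _)%E; last first.
    by have [->|->] := normalizeZ (chart c) t0; rewrite ?fN.
  rewrite -EFinM; congr EFin; congr (_ * _); rewrite !indicE.
  congr (nat_of_bool _)%:R; apply/idP/idP; rewrite !inE /punctured_ball/= in_itv/=.
    move=> /andP[_]; rewrite enormZ -ler_pdivlMr//.
    by rewrite mul1r ler_norml.
  rewrite -ler_norml enormZ mulr_gt0 ?normr_gt0//=.
  by rewrite -[X in _ <= X -> _]mul1r ler_pdivlMr.
rewrite ge0_integralZl//; last 2 first.
- by apply/measurable_EFinP; apply: measurable_funM; msr; exact: measurable_indic.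
- by move=> t _; nonneg.
rewrite integral_sqr_ball; last by rewrite invr_ge0 ltW.
rewrite muleCA -EFinM muleC; congr (_%:E * _)%E.
by field; rewrite gt_eqF.
Qed.
End sphere.

(** * Orthonormal frames *)
Section vectors.
Context {R : realType}.
Local Notation T1 := (measurableTypeR R).
Local Notation T2 := (T1 * T1)%type.
Implicit Types x y z u v w e : E3 R.

Definition cross u v : E3 R :=
  ((u.1.2 * v.2 - u.2 * v.1.2, u.2 * v.1.1 - u.1.1 * v.2),
   u.1.1 * v.1.2 - u.1.2 * v.1.1).

Lemma eq3 x y : x.1.1 = y.1.1 -> x.1.2 = y.1.2 -> x.2 = y.2 -> x = y.
Proof. by case: x y => [[a b] c] [[a' b'] c'] /= -> -> ->. Qed.

Lemma dot_eq0 x : (dot x x == 0) = (x == 0).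
Proof. by apply: negb_inj; rewrite -enorm_gt0 sqrtr_gt0 lt0r dot_ge0 andbT. Qed.

Lemma dot0l x : dot 0 x = 0. Proof. by rewrite /dot/=; ring. Qed.
Lemma dot0r x : dot x 0 = 0. Proof. by rewrite /dot/=; ring. Qed.
Lemma dotNl x y : dot (- x) y = - dot x y. Proof. by rewrite /dot/=; ring. Qed.
Lemma dotNr x y : dot x (- y) = - dot x y. Proof. by rewrite /dot/=; ring. Qed.

Lemma dot_crossl u v : dot (cross u v) u = 0.
Proof. by rewrite /dot/=; ring. Qed.

Lemma dot_crossr u v : dot (cross u v) v = 0.
Proof. by rewrite /dot/=; ring. Qed.

(** The square of det(u, v, z) is the Gram determinant of u, v and z. *)
Lemma dot_cross_sqr u v z : dot (cross u v) z ^+ 2 =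
  dot u u * (dot v v * dot z z - dot v z ^+ 2)
  - dot u v * (dot u v * dot z z - dot v z * dot u z)
  + dot u z * (dot u v * dot v z - dot v v * dot u z).
Proof. by rewrite /dot/=; ring. Qed.

Lemma lagrange u v : dot (cross u v) (cross u v) =
  dot u u * dot v v - dot u v ^+ 2.
Proof. by rewrite /dot/=; ring. Qed.

Lemma dot_le_enorm x y : `|dot x y| <= enorm x * enorm y.
Proof.
rewrite -(@ler_pXn2r _ 2)// ?nnegrE ?mulr_ge0 ?enorm_ge0//.
rewrite exprMn !enorm_sqr -normrX ger0_norm ?sqr_ge0// -subr_ge0 -lagrange.
exact: dot_ge0.
Qed.

(* The frame is (e, f, u) with f = u x e. *)
Section orthonormal.
Variables u e : E3 R.
Hypotheses (uu : dot u u = 1) (ee : dot e e = 1) (ue : dot u e = 0).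
Let f := cross u e.

Lemma frame_ff : dot f f = 1.
Proof. by rewrite lagrange uu ee ue; ring. Qed.

Lemma parseval z : dot z z = dot z e ^+ 2 + dot z f ^+ 2 + dot z u ^+ 2.
Proof.
rewrite [dot z f]dotC dot_cross_sqr uu ee ue [dot e z]dotC [dot u z]dotC; ring.
Qed.

Lemma frame_decomp z : z = dot z e *: e + dot z f *: f + dot z u *: u.
Proof.
apply/eqP; rewrite -subr_eq0 -dot_eq0; set r := (_ - _).
have fe : dot f e = 0 := dot_crossr _ _.
have fu : dot f u = 0 := dot_crossl _ _.
rewrite (parseval r) /r !(dotDl, dotNl, dotZl) ee frame_ff uu fe fu.
by rewrite [dot e f]dotC [dot e u]dotC ue fe [dot u f]dotC fu; apply/eqP; ring.
Qed.

(** This is the third coordinate of e x (u x e) = u: the area of the unit square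
    on e and f, projected to the horizontal plane. *)
Lemma frame_det : e.1.1 * f.1.2 - e.1.2 * f.1.1 = u.2.
Proof.
transitivity (dot e e * u.2 - dot u e * e.2).
  by rewrite /dot /f /cross/=; ring.
by rewrite ee ue; ring.
Qed.

End orthonormal.

End vectors.

(** * The cone over a spherically convex set *)
Section cones.
Context {R : realType}.
Local Notation T1 := (measurableTypeR R).
Local Notation T2 := (T1 * T1)%type.
Implicit Types x y z u v w e : E3 R.
Variable Om : set (E3 R).
Hypothesis hOm : spherically_convex Om.

Lemma coneP z : cone Om z <-> exists t w, [/\ 0 <= t, Om w & z = t *: w].
Proof.
split=> [[t /=]|[t [w [t0 Ow ->]]]].
  by rewrite in_itv/= andbT => t0 [w Ow <-]; exists t, w.
by exists t; rewrite /= ?in_itv/= ?t0//; exists w.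
Qed.

Lemma cone_scale (s : R) z : 0 <= s -> cone Om z -> cone Om (s *: z).
Proof.
move=> s0 /coneP[t [w [t0 Ow ->]]]; apply/coneP; exists (s * t), w.
by split=> //; [exact: mulr_ge0|rewrite scalerA].
Qed.

Lemma cone_add y z : cone Om y -> cone Om z -> cone Om (y + z).
Proof.
have [_ _ _ cvx _] := hOm => Cy Cz.
have h0 : 0 <= (2^-1 : R) by rewrite invr_ge0.
have h1 : (2^-1 : R) <= 1 by lra.
have /set_mem := cvx y z (Itv01 h0 h1) (mem_set Cy) (mem_set Cz).
move=> /(cone_scale (@ler0n R 2)); congr (cone Om _).
rewrite -[conv _ _ _]/(2^-1 *: y + (1 - 2^-1) *: z) scalerDr !scalerA.
by congr (_ + _); rewrite -[RHS]scale1r; congr (_ *: _); field.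
Qed.

Lemma cone_Om w : Om w -> cone Om w.
Proof. by move=> Ow; apply/coneP; exists 1, w; rewrite scale1r. Qed.

(** If z = - y and y is nonzero, the cone contains the line R y. *)
Lemma cone_pointed y z : cone Om y -> cone Om z -> y + z = 0 -> y = 0.
Proof.
have [_ _ _ _ noline] := hOm => Cy Cz /eqP; rewrite addr_eq0 => /eqP yz.
apply: contra_notP noline => /eqP y0; exists 0, y; split=> // s.
rewrite add0r; have [s0|s0] := leP 0 s; first exact: cone_scale.
rewrite (_ : s *: y = (- s) *: z); last by rewrite yz scaleNr scalerN.
by apply: cone_scale => //; rewrite oppr_ge0 ltW.
Qed.

Lemma Om_dot1 w : Om w -> dot w w = 1.
Proof.
have [_ _ sph _ _] := hOm => /sph; rewrite /sphere/= => w1.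
by rewrite -enorm_sqr w1 expr1n.
Qed.

Lemma dot_orth_proj u w x : dot (orth_proj u w) x = dot w x - dot w u * dot u x.
Proof. by rewrite /orth_proj dotDl dotNl dotZl. Qed.

Lemma orth_projD u y z : orth_proj u (y + z) = orth_proj u y + orth_proj u z.
Proof. by rewrite /orth_proj dotDl scalerDl opprD addrACA. Qed.

Lemma orth_projZ u (t : R) z : orth_proj u (t *: z) = t *: orth_proj u z.
Proof. by rewrite /orth_proj dotZl scalerBr scalerA. Qed.

Lemma normalize_pscale (t : R) x : 0 < t -> normalize (t *: x) = normalize x.
Proof.
move=> t0; rewrite /normalize enormZ gtr0_norm// scalerA invfM mulrAC.
by rewrite mulVf ?gt_eqF// mul1r.
Qed.

Lemma angleE x y : angle x y = acos (dot (normalize x) (normalize y)).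
Proof.
rewrite /angle /normalize dotZl dotZr invfM; congr acos; ring.
Qed.

Lemma dot_normalize x : x != 0 -> dot (normalize x) (normalize x) = 1.
Proof. by move=> x0; rewrite -enorm_sqr enorm_normalize// expr1n. Qed.

Definition shadow u w : E3 R := normalize (orth_proj u w).

Section outside_direction.
Variable u : E3 R.
Hypothesis hu : outside Om u.

Lemma outside_dot1 : dot u u = 1.
Proof. by have [us _ _] := hu; rewrite -enorm_sqr [enorm u]us expr1n. Qed.

Lemma cone_proj_eq0 z : cone Om z -> orth_proj u z = 0 -> z = 0.
Proof.
have [_ nu nNu] := hu.
move=> /coneP[t [w [t0 Ow ->]]]; rewrite orth_projZ => /eqP.
rewrite scaler_eq0 => /orP[/eqP ->|]; first by rewrite scale0r.
rewrite subr_eq0 => /eqP we; exfalso.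
have := Om_dot1 Ow; rewrite {1}we dotZl [dot u w]dotC -expr2 => /eqP.
rewrite sqrf_eq1 => /orP[] /eqP wu; rewrite wu in we.
  by apply: nu; rewrite -[u]scale1r -we.
by apply: nNu; rewrite -[u]scale1r -scaleNr -we.
Qed.

Lemma orth_proj_neq0 w : Om w -> orth_proj u w != 0.
Proof.
move=> Ow; apply/eqP => /(cone_proj_eq0 (cone_Om Ow)) w0.
by have /eqP := Om_dot1 Ow; rewrite w0 dot0l eq_sym oner_eq0.
Qed.

Lemma dot_shadow w : Om w -> dot (shadow u w) (shadow u w) = 1.
Proof. by move=> Ow; exact/dot_normalize/orth_proj_neq0. Qed.

Lemma dot_shadowu w : dot (shadow u w) u = 0.
Proof.
by rewrite /shadow /normalize dotZl dot_orth_proj outside_dot1 mulr1 subrr mulr0.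
Qed.

(** The projected cone contains no line: a vanishing positive combination of
    shadows lifts to an element of the cone on the line R u, which must be zero
    as neither u nor -u is in Om, and the cone itself is pointed. *)
Lemma shadow_comb_neq0 (a b d : R) w1 w2 w3 : Om w1 -> Om w2 -> Om w3 ->
  0 < a -> 0 <= b -> 0 <= d ->
  a *: shadow u w1 + b *: shadow u w2 + d *: shadow u w3 != 0.
Proof.
move=> O1 O2 O3 a0 b0 d0; apply/eqP => e0.
have pos w : Om w -> 0 < (enorm (orth_proj u w))^-1.
  by move=> Ow; rewrite invr_gt0 enorm_gt0 orth_proj_neq0.
set z1 := (a * (enorm (orth_proj u w1))^-1) *: w1.
set z2 := (b * (enorm (orth_proj u w2))^-1) *: w2.
set z3 := (d * (enorm (orth_proj u w3))^-1) *: w3.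
have C1 : cone Om z1 by apply: cone_scale (cone_Om O1); rewrite mulr_ge0// ltW// pos.
have C2 : cone Om z2 by apply: cone_scale (cone_Om O2); rewrite mulr_ge0// ltW// pos.
have C3 : cone Om z3 by apply: cone_scale (cone_Om O3); rewrite mulr_ge0// ltW// pos.
have z0 : z1 + (z2 + z3) = 0.
  apply: cone_proj_eq0; first by apply: cone_add => //; exact: cone_add.
  by rewrite !orth_projD !orth_projZ -!scalerA addrA; exact: e0.
have /eqP := cone_pointed C1 (cone_add C2 C3) z0.
rewrite scaler_eq0 mulf_eq0 !gt_eqF ?pos//= => /eqP w10.
by have /eqP := Om_dot1 O1; rewrite w10 dot0l eq_sym oner_eq0.
Qed.

End outside_direction.
End cones.

(** * Continuity at a point *)
Section continuity.
Context {R : realType} {T : topologicalType}.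
Variable a : T.

Definition continuous_at (U : topologicalType) (f : T -> U) :=
  {for a, continuous f}.

Lemma continuous_at_cst (U : topologicalType) (c : U) :
  continuous_at (fun=> c).
Proof. exact: cvg_cst. Qed.

Lemma continuous_at_comp (U V : topologicalType) (f : T -> U) (h : U -> V) :
  continuous_at f -> {for f a, continuous h} -> continuous_at (fun z => h (f z)).
Proof. by move=> cf ch; apply: continuous_comp. Qed.

Lemma continuous_at_fst (U V : topologicalType) (f : T -> U * V) :
  continuous_at f -> continuous_at (fun z => (f z).1).
Proof. move=> cf; apply: (continuous_at_comp cf (h := fst)); exact: cvg_fst. Qed.

Lemma continuous_at_snd (U V : topologicalType) (f : T -> U * V) :
  continuous_at f -> continuous_at (fun z => (f z).2).
Proof. move=> cf; apply: (continuous_at_comp cf (h := snd)); exact: cvg_snd. Qed.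

Lemma continuous_at_pair (U V : topologicalType) (f : T -> U) (g : T -> V) :
  continuous_at f -> continuous_at g -> continuous_at (fun z => (f z, g z)).
Proof. by move=> cf cg; exact: cvg_pair. Qed.

Lemma continuous_atD (f g : T -> R) :
  continuous_at f -> continuous_at g -> continuous_at (fun z => f z + g z).
Proof. by move=> cf cg; exact: cvgD. Qed.

Lemma continuous_atN (f : T -> R) :
  continuous_at f -> continuous_at (fun z => - f z).
Proof. by move=> cf; exact: cvgN. Qed.

Lemma continuous_atM (f g : T -> R) :
  continuous_at f -> continuous_at g -> continuous_at (fun z => f z * g z).
Proof. by move=> cf cg; exact: cvgM. Qed.

Lemma continuous_atV (f : T -> R) :
  f a != 0 -> continuous_at f -> continuous_at (fun z => (f z)^-1).
Proof. by move=> f0 cf; exact: cvgV. Qed.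

Lemma continuous_at_sqrt (f : T -> R) :
  continuous_at f -> continuous_at (fun z => Num.sqrt (f z)).
Proof. by move=> cf; apply: (continuous_at_comp cf); exact: sqrt_continuous. Qed.

Lemma continuous_at_dot (f g : T -> E3 R) :
  continuous_at f -> continuous_at g -> continuous_at (fun z => dot (f z) (g z)).
Proof.
move=> cf cg; rewrite /dot; repeat apply: continuous_atD; apply: continuous_atM.
- exact/continuous_at_fst/continuous_at_fst.
- exact/continuous_at_fst/continuous_at_fst.
- exact/continuous_at_snd/continuous_at_fst.
- exact/continuous_at_snd/continuous_at_fst.
- exact/continuous_at_snd.
- exact/continuous_at_snd.
Qed.

Lemma continuous_at_enorm (f : T -> E3 R) :
  continuous_at f -> continuous_at (fun z => enorm (f z)).
Proof. by move=> cf; apply: continuous_at_sqrt; exact: continuous_at_dot. Qed.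

Lemma continuous_at_scale (c : T -> R) (f : T -> E3 R) :
  continuous_at c -> continuous_at f ->
  continuous_at (fun z => c z *: f z : E3 R).
Proof.
move=> cc cf.
apply: (@continuous_at_pair _ _ (fun z => (c z * (f z).1.1, c z * (f z).1.2))
  (fun z => c z * (f z).2)).
  apply: continuous_at_pair; apply: continuous_atM => //.
    exact/continuous_at_fst/continuous_at_fst.
  exact/continuous_at_snd/continuous_at_fst.
by apply: continuous_atM => //; exact: continuous_at_snd.
Qed.

Lemma continuous_atB3 (f g : T -> E3 R) :
  continuous_at f -> continuous_at g -> continuous_at (fun z => f z - g z).
Proof.
move=> cf cg.
apply: (@continuous_at_pair _ _
  (fun z => ((f z).1.1 - (g z).1.1, (f z).1.2 - (g z).1.2))
  (fun z => (f z).2 - (g z).2)).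
  apply: continuous_at_pair; (apply: continuous_atD; last apply: continuous_atN).
  - exact/continuous_at_fst/continuous_at_fst.
  - exact/continuous_at_fst/continuous_at_fst.
  - exact/continuous_at_snd/continuous_at_fst.
  - exact/continuous_at_snd/continuous_at_fst.
apply: continuous_atD; last apply: continuous_atN; exact: continuous_at_snd.
Qed.

Lemma continuous_at_orth_proj (f g : T -> E3 R) :
  continuous_at f -> continuous_at g ->
  continuous_at (fun z => orth_proj (f z) (g z)).
Proof.
move=> cf cg; apply: continuous_atB3 => //; apply: continuous_at_scale => //.
exact: continuous_at_dot.
Qed.

Lemma continuous_at_normalize (f : T -> E3 R) :
  f a != 0 -> continuous_at f -> continuous_at (fun z => normalize (f z)).
Proof.
move=> fa cf; apply: continuous_at_scale => //; apply: continuous_atV.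
  by rewrite gt_eqF// enorm_gt0.
exact: continuous_at_enorm.
Qed.
End continuity.

(** * Vectors orthogonal to some point of the set *)
Section compactness.
Context {R : realType}.
Implicit Types x y z u v w e : E3 R.
Variable Om : set (E3 R).
Hypothesis hOm : spherically_convex Om.

Lemma compact_Om : compact Om.
Proof.
have [_ cOm _ _ _] := hOm.
pose I : set (measurableTypeR R) := `[-1, 1]%classic.
apply: (@subclosed_compact _ _ ((I `*` I) `*` I)) => //.
  by apply: compact_setX; [apply: compact_setX|]; exact: segment_compact.
move=> w Ow; have := Om_dot1 hOm Ow; rewrite /dot /I/= !in_itv/= -!ler_norml => w1.
have le1 (t s : R) : 0 <= s -> t * t + s = 1 -> `|t| <= 1.
  move=> s0 ts; rewrite -(@ler_pXn2r _ 2)// ?nnegrE// -normrX.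
  by rewrite ger0_norm ?sqr_ge0// expr2; lra.
have q t : 0 <= t * t :> R by rewrite -expr2 sqr_ge0.
split; first split.
- by apply: (le1 _ (w.1.2 * w.1.2 + w.2 * w.2)); [exact: addr_ge0|lra].
- by apply: (le1 _ (w.1.1 * w.1.1 + w.2 * w.2)); [exact: addr_ge0|lra].
- by apply: (le1 _ (w.1.1 * w.1.1 + w.1.2 * w.1.2)); [exact: addr_ge0|lra].
Qed.

Definition orthogonal_cone : set (E3 R) := [set x | exists2 w, Om w & dot x w = 0].

(** For x outside, |<x, w>| has a positive minimum m over the compact set Om,
    and the ball of radius m around x avoids the set by the Cauchy-Schwarz
    inequality. *)
Lemma closed_orthogonal_cone : closed orthogonal_cone.
Proof.
have cOm := compact_Om; have [Om0 _ _ _ _] := hOm.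
rewrite -[orthogonal_cone]setCK; apply: open_closedC; rewrite openE => x xZ.
have [w0 Ow0 minw0] : exists2 w0, w0 \in Om & forall w, w \in Om -> `|dot x w0| <= `|dot x w|.
  apply: compact_EVT_min => //; apply: continuous_in_subspaceT => w _.
  apply: (@continuous_at_comp _ w R R (dot x) (@Num.norm _ _)); last exact: norm_continuous.
  by apply: continuous_at_dot; [exact: continuous_at_cst|exact: cvg_id].
have m0 : 0 < `|dot x w0|.
  rewrite normr_gt0; apply/eqP => xw0; apply: xZ; exists w0 => //.
  exact: set_mem.
pose f y : R := enorm (y - x).
have : continuous_at x f.
  rewrite /f; apply: continuous_at_enorm; apply: continuous_atB3; first exact: cvg_id.
  exact: continuous_at_cst.
move=> /cvgr_lt/(_ `|dot x w0|); rewrite {1}/f subrr /enorm dot0l sqrtr0.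
move=> /(_ m0); apply: filterS => y yx [w Ow yw].
have := minw0 w (mem_set Ow); apply/negP; rewrite -ltNge.
rewrite (_ : dot x w = - dot (y - x) w); last by rewrite dotDl yw dotNl; ring.
rewrite normrN (le_lt_trans (dot_le_enorm _ _))//.
by rewrite /enorm (Om_dot1 hOm Ow) sqrtr1 mulr1.
Qed.

Lemma orthogonal_coneZ (t : R) x : t != 0 ->
  orthogonal_cone (t *: x) <-> orthogonal_cone x.
Proof.
move=> t0; split=> -[w Ow xw]; exists w => //; last by rewrite dotZl xw mulr0.
by move/eqP: xw; rewrite dotZl mulf_eq0 (negbTE t0)/= => /eqP.
Qed.

Lemma tildeE : tilde Om = orthogonal_cone `&` sphere.
Proof.
apply/seteqP; split=> x.
  by move=> [sx [w Ow xw]]; split=> //; exists w.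
by move=> [[w Ow xw] sx]; split=> //; exists w.
Qed.

End compactness.

(** * The dihedral angle and the sector of orthogonal directions *)
Lemma le_acos {R : realType} (x y : R) : -1 <= x -> x <= y -> y <= 1 ->
  acos y <= acos x.
Proof.
move=> x1 xy y1.
have bx : -1 <= x <= 1 by rewrite x1 (le_trans xy).
have by_ : -1 <= y <= 1 by rewrite y1 andbT (le_trans x1).
have ix : acos x \in `[0, pi] by rewrite in_itv/= acos_ge0// acos_lepi.
have iy : acos y \in `[0, pi] by rewrite in_itv/= acos_ge0// acos_lepi.
by rewrite leNgt -(ltr_cos ix iy) !acosK ?in_itv//= -leNgt.
Qed.

Lemma acos_atan {R : realType} (c s : R) : 0 < c -> 0 <= s -> c ^+ 2 + s ^+ 2 = 1 ->
  acos (c ^+ 2 - s ^+ 2) = 2 * atan (s / c).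
Proof.
move=> c0 s0 cs.
have a0 : 0 <= atan (s / c) by rewrite -(@atan0 R); apply: le_atan; rewrite divr_ge0// ltW.
have a1 := @atan_ltpi2 R (s / c).
rewrite -[RHS]cosK ?in_itv/=; last by lra.
congr acos; rewrite mulr_natl cos_mulr2n cos_atan exprVn sqr_sqrtr ?addr_ge0 ?sqr_ge0//.
rewrite (_ : 1 + (s / c) ^+ 2 = c ^- 2); last first.
  transitivity ((c ^+ 2 + s ^+ 2) * c ^- 2); last by rewrite cs mul1r.
  by field; rewrite gt_eqF.
rewrite invrK; lra.
Qed.

Lemma sin_atan2 {R : realType} (T : R) : sin (2 * atan T) = 2 * (T / (1 + T ^+ 2)).
Proof.
rewrite mulr_natl sin_mulr2n -mulr_natl; congr (2 * _).
have c0 : cos (atan T) != 0.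
  by rewrite cos_atan invr_eq0 gt_eqF// sqrtr_gt0 ltr_wpDr// sqr_ge0.
have cs := cos2Dsin2 (atan T).
rewrite -[in RHS](atanK T) /tan; set c := cos _ in c0 cs *; set s := sin _ in cs *.
rewrite (_ : 1 + (s / c) ^+ 2 = c ^- 2); first by field.
transitivity ((c ^+ 2 + s ^+ 2) * c ^- 2); last by rewrite cs mul1r.
by field.
Qed.

(** Let k1 and k2 be the unit vectors of polar angles d/2 and -d/2, and let the
    unit vector (X, Y) have polar angle t.  The two strict inequalities say that
    t lies strictly between d/2 and pi - d/2; then t + d/2 is between d and pi,
    so that the angle from (X, Y) to k2 exceeds d, against the other
    inequality. *)
Lemma planar_separation {R : realType} (c s X Y : R) : 0 < c -> 0 <= s ->
  c ^+ 2 + s ^+ 2 = 1 -> X ^+ 2 + Y ^+ 2 = 1 ->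
  c ^+ 2 - s ^+ 2 <= c * X - s * Y -> s * X < c * Y -> - (s * X) < c * Y -> False.
Proof.
move=> c0 s0 cs XY h1 h2 h3.
(* cosine and sine of t + d/2, then of d *)
pose A := c * X - s * Y; pose B := s * X + c * Y.
pose C := c ^+ 2 - s ^+ 2; pose S := 2 * s * c.
have AB : A ^+ 2 + B ^+ 2 = C ^+ 2 + S ^+ 2.
  transitivity ((c ^+ 2 + s ^+ 2) * (X ^+ 2 + Y ^+ 2)); first by rewrite /A /B; ring.
  transitivity ((c ^+ 2 + s ^+ 2) * (c ^+ 2 + s ^+ 2)); first by rewrite XY cs.
  by rewrite /C /S; ring.
have B0 : 0 < B by rewrite /B; lra.
have S0 : 0 <= S by rewrite /S !mulr_ge0// ltW.
have AC : C <= A by [].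
have BC : A * S < B * C.
  rewrite -subr_gt0 (_ : _ - _ = (c ^+ 2 + s ^+ 2) * (c * Y - s * X)); last first.
    by rewrite /A /B /C /S; ring.
  by rewrite cs mul1r subr_gt0.
have SCA : S * C <= A * S by rewrite mulrC ler_wpM2r.
suff : B * C <= A * S by rewrite leNgt BC.
have [C0|C0] := leP 0 C.
  apply: le_trans SCA; apply: ler_wpM2r => //.
  rewrite -(@ler_pXn2r _ 2)// ?nnegrE ?(ltW B0)//.
  have : C ^+ 2 <= A ^+ 2 by rewrite ler_pXn2r// ?nnegrE// (le_trans C0).
  lra.
have [A0|A0] := leP 0 A.
  by rewrite (@le_trans _ _ 0)//; [rewrite pmulr_rle0// ltW|exact: mulr_ge0].
apply: le_trans SCA; apply: ler_wnM2r; first exact: ltW.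
rewrite -(@ler_pXn2r _ 2)// ?nnegrE ?(ltW B0)//.
have : (- A) ^+ 2 <= (- C) ^+ 2.
  by rewrite ler_pXn2r// ?nnegrE ?oppr_ge0 ?lerN2// ltW.
by rewrite !sqrrN; lra.
Qed.

Lemma dot_comb2 {R : realType} (e f : E3 R) (a b a' b' : R) :
  dot e e = 1 -> dot f f = 1 -> dot f e = 0 ->
  dot (a *: e + b *: f) (a' *: e + b' *: f) = a * a' + b * b'.
Proof.
move=> ee ff fe; rewrite !(dotDl, dotDr, dotZl, dotZr) ee ff fe dotC fe; ring.
Qed.

Lemma comb2_eq0 {R : realType} (e f : E3 R) (a b a1 b1 a2 b2 c1 c2 : R) :
  a + c1 * a1 + c2 * a2 = 0 -> b + c1 * b1 + c2 * b2 = 0 ->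
  1 *: (a *: e + b *: f) + c1 *: (a1 *: e + b1 *: f) +
    c2 *: (a2 *: e + b2 *: f) = 0.
Proof.
move=> ha hb; transitivity ((a + c1 * a1 + c2 * a2) *: e +
  (b + c1 * b1 + c2 * b2) *: f); last by rewrite ha hb !scale0r addr0.
by apply: eq3; rewrite /= /GRing.scale/=; ring.
Qed.

Section dihedral_sector.
Context {R : realType}.
Implicit Types x y z u v w e : E3 R.
Variable Om : set (E3 R).
Hypothesis hOm : spherically_convex Om.
Variable u : E3 R.
Hypothesis hu : outside Om u.
Let k := shadow u.

Let uu : dot u u = 1 := outside_dot1 hu.
Let kk w (Ow : Om w) : dot (k w) (k w) = 1 := dot_shadow hOm hu Ow.

Lemma dot_shadow_bound w1 w2 : Om w1 -> Om w2 -> -1 <= dot (k w1) (k w2) <= 1.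
Proof.
move=> O1 O2; rewrite -ler_norml (le_trans (dot_le_enorm _ _))//.
by rewrite /enorm !kk// sqrtr1 mulr1.
Qed.

Lemma anglesE : [set angle x y | x in (orth_proj u @` cone Om) `\ 0 &
    y in (orth_proj u @` cone Om) `\ 0] =
  [set acos (dot (k w1) (k w2)) | w1 in Om & w2 in Om].
Proof.
have dir z : ((orth_proj u @` cone Om) `\ 0) z ->
    exists2 w, Om w & normalize z = k w.
  move=> [[_ /coneP[t [w [t0 Ow ->]]] <-] /eqP].
  rewrite orth_projZ scaler_eq0 negb_or => /andP[t1 _]; exists w => //.
  by rewrite normalize_pscale// lt0r t1.
have dirV w : Om w -> ((orth_proj u @` cone Om) `\ 0) (orth_proj u w).
  move=> Ow; split; last by apply/eqP; exact: (orth_proj_neq0 hOm hu Ow).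
  by exists w => //; exact: cone_Om.
apply/seteqP; split=> a.
  move=> [x /dir[w1 O1 xw] [y /dir[w2 O2 yw] <-]].
  by exists w1 => //; exists w2 => //; rewrite angleE xw yw.
move=> [w1 O1 [w2 O2 <-]].
exists (orth_proj u w1); first exact: dirV.
by exists (orth_proj u w2); [exact: dirV|rewrite angleE].
Qed.

(** The dihedral angle is a maximum, attained at two points of the compact
    set Om. *)
Lemma dihedral_extremal : exists w1 w2, [/\ Om w1, Om w2,
  dihedral Om u = acos (dot (k w1) (k w2)) &
  forall w w', Om w -> Om w' -> dot (k w1) (k w2) <= dot (k w) (k w')].
Proof.
have [[w0 Ow0] _ _ _ _] := hOm.
have [[w1 w2] /set_mem[/= O1 O2] min12] : exists2 p : E3 R * E3 R,
    p \in Om `*` Om & forall q, q \in Om `*` Om ->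
    dot (k p.1) (k p.2) <= dot (k q.1) (k q.2).
  apply: compact_EVT_min; first by exists (w0, w0).
    by apply: compact_setX; exact: compact_Om.
  apply: continuous_in_subspaceT => -[w w'] /set_mem[/= Ow Ow'].
  apply: (@continuous_at_dot _ _ (w, w') (fun p => k p.1) (fun p => k p.2));
    apply: continuous_at_normalize.
  - exact: (orth_proj_neq0 hOm hu Ow).
  - apply: continuous_at_orth_proj; first exact: continuous_at_cst.
    by apply: continuous_at_fst; exact: cvg_id.
  - exact: (orth_proj_neq0 hOm hu Ow').
  - apply: continuous_at_orth_proj; first exact: continuous_at_cst.
    by apply: continuous_at_snd; exact: cvg_id.
have {}min12 w w' : Om w -> Om w' -> dot (k w1) (k w2) <= dot (k w) (k w').
  by move=> Ow Ow'; apply: (min12 (w, w')); exact: mem_set.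
exists w1, w2; split=> //; rewrite /dihedral /opening_angle anglesE.
set S := (X in sup X).
have ubS : ubound S (acos (dot (k w1) (k w2))).
  move=> _ [w Ow [w' Ow' <-]].
  have /andP[b1 _] := dot_shadow_bound O1 O2.
  have /andP[_ b2] := dot_shadow_bound Ow Ow'.
  by apply: le_acos => //; exact: min12.
have Smax : S (acos (dot (k w1) (k w2))) by exists w1 => //; exists w2.
apply/eqP; rewrite eq_le; apply/andP; split.
  by apply: ge_sup => //; exists (acos (dot (k w1) (k w2))).
by apply: ub_le_sup => //; exists (acos (dot (k w1) (k w2))).
Qed.

Let bis w1 w2 : E3 R := normalize (k w1 + k w2).

Let bis_neq0 w1 w2 : Om w1 -> Om w2 -> k w1 + k w2 != 0.
Proof.
move=> O1 O2.
have := shadow_comb_neq0 hOm hu O1 O2 O1 ltr01 ler01 (lexx 0).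
by rewrite !scale1r scale0r addr0.
Qed.

Let bisE w1 w2 : Om w1 -> Om w2 -> k w1 + k w2 = enorm (k w1 + k w2) *: bis w1 w2.
Proof.
move=> O1 O2; rewrite /bis /normalize scalerA mulfV ?scale1r//.
by rewrite gt_eqF// enorm_gt0 bis_neq0.
Qed.

Let bis_unit w1 w2 : Om w1 -> Om w2 -> dot (bis w1 w2) (bis w1 w2) = 1.
Proof. by move=> O1 O2; apply: dot_normalize; exact: bis_neq0. Qed.

Let dot_bisu w1 w2 : dot u (bis w1 w2) = 0.
Proof.
by rewrite dotC /bis /normalize dotZl dotDl !(dot_shadowu hu) addr0 mulr0.
Qed.

Let dot_bis_cross w1 w2 : Om w1 -> Om w2 ->
  dot (k w2) (cross u (bis w1 w2)) = - dot (k w1) (cross u (bis w1 w2)).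
Proof.
move=> O1 O2; apply/eqP; rewrite -addr_eq0 addrC -dotDl bisE// dotZl.
by rewrite [dot (bis _ _) _]dotC dot_crossr mulr0.
Qed.

Let dot_bis w1 w2 : Om w1 -> Om w2 ->
  dot (k w2) (bis w1 w2) = dot (k w1) (bis w1 w2).
Proof.
move=> O1 O2; rewrite /bis /normalize !dotZr !dotDr !kk//; congr (_ * _).
by rewrite addrC dotC.
Qed.

Let dot_bis_gt0 w1 w2 : Om w1 -> Om w2 -> 0 < dot (k w1) (bis w1 w2).
Proof.
move=> O1 O2.
suff : 0 < dot (k w1 + k w2) (bis w1 w2) by rewrite dotDl dot_bis//; lra.
by rewrite bisE// dotZl bis_unit// mulr1 enorm_gt0 bis_neq0.
Qed.

(** Let e be the direction of the bisector of the extremal shadows k1 and k2,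
    which are c e +- s f with f = u x e.  By maximality of the angle between
    them, every other shadow lies in the convex sector that they span, for
    otherwise it would be at a larger angle from one of them, or its opposite
    would lie in that sector, against [shadow_comb_neq0].  A vector of the plane
    is orthogonal to some ray of this sector exactly when it lies in the double
    sector of the same opening around f, whence the condition
    |p| <= T |q| with T = s / c. *)
Lemma sector_frame : exists e T, [/\ dot e e = 1, dot u e = 0, 0 <= T,
  dihedral Om u = 2 * atan T &
  forall p q, orthogonal_cone Om (p *: e + q *: cross u e) <-> `|p| <= T * `|q| ].
Proof.
have [w1 [w2 [ O1 O2 DE min12]]] := dihedral_extremal.
wlog s0 : w1 w2 O1 O2 DE min12 / 0 <= dot (k w1) (cross u (bis w1 w2)).
  move=> wlog_s; have [s0|s0] := leP 0 (dot (k w1) (cross u (bis w1 w2))).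
    exact: (wlog_s w1 w2).
  apply: (wlog_s w2 w1) => //; [by rewrite dotC|by move=> *; rewrite dotC min12|].
  rewrite (_ : bis w2 w1 = bis w1 w2); last by rewrite /bis addrC.
  by rewrite dot_bis_cross// oppr_ge0 ltW.
set e := bis w1 w2 in s0 *; set f := cross u e in s0 *.
have ee : dot e e = 1 by exact: bis_unit.
have ue : dot u e = 0 by exact: dot_bisu.
have ff : dot f f = 1 by exact: frame_ff.
have fe : dot f e = 0 := dot_crossr _ _.
have ef : dot e f = 0 by rewrite dotC.
set c := dot (k w1) e; set s := dot (k w1) f in s0 *.
have c0 : 0 < c by exact: dot_bis_gt0.
have k1E : k w1 = c *: e + s *: f.
  by rewrite [LHS](frame_decomp uu ee ue) (dot_shadowu hu) scale0r addr0.
have k2E : k w2 = c *: e + (- s) *: f.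
  rewrite [LHS](frame_decomp uu ee ue) (dot_shadowu hu) scale0r addr0.
  by rewrite dot_bis_cross// dot_bis.
have cs : c ^+ 2 + s ^+ 2 = 1.
  by rewrite -(kk O1) (parseval uu ee ue) (dot_shadowu hu) expr0n/= addr0.
have c0E : dot (k w1) (k w2) = c ^+ 2 - s ^+ 2.
  by rewrite k1E k2E dot_comb2//; ring.
have sector_in w : Om w -> c * `|dot (k w) f| <= s * dot (k w) e.
  move=> Ow; set X := dot (k w) e; set Y := dot (k w) f.
  have kE : k w = X *: e + Y *: f.
    by rewrite [LHS](frame_decomp uu ee ue) (dot_shadowu hu) scale0r addr0.
  have XY : X ^+ 2 + Y ^+ 2 = 1.
    by rewrite -(kk Ow) (parseval uu ee ue) (dot_shadowu hu) expr0n/= addr0.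
  have h1 : c ^+ 2 - s ^+ 2 <= c * X + s * Y.
    rewrite -c0E (le_trans (min12 _ _ O1 Ow))// k1E kE.
    by rewrite dot_comb2//; lra.
  have h2 : c ^+ 2 - s ^+ 2 <= c * X - s * Y.
    rewrite -c0E (le_trans (min12 _ _ Ow O2))// k2E kE.
    by rewrite dot_comb2//; lra.
  rewrite leNgt; apply/negP => h4.
  (* otherwise the direction opposite to w lies between k w1 and k w2 *)
  have h3 : - (s * X) < c * `|Y|.
    have [s_eq0|s_neq0] := eqVneq s 0.
      by move: h4; rewrite s_eq0 !mul0r oppr0.
    have sp : 0 < s by rewrite lt0r s_neq0.
    rewrite ltNge; apply/negP => h3.
    have YX : `|Y| / s <= - X / c.
      by rewrite ler_pdivrMr// mulrAC ler_pdivlMr//; lra.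
    have /andP[Y1 Y2] : - (- X / c) <= Y / s <= - X / c.
      by rewrite -ler_norml normrM normfV (gtr0_norm sp).
    have a0 : 0 <= (- X / c - Y / s) / 2 by lra.
    have b0 : 0 <= (- X / c + Y / s) / 2 by lra.
    have /eqP := shadow_comb_neq0 hOm hu Ow O1 O2 ltr01 a0 b0; apply.
    by rewrite -/k k1E k2E kE; apply: comb2_eq0; field; rewrite ?gt_eqF.
  have [Y0|Y0] := leP 0 Y.
    rewrite ger0_norm// in h3 h4.
    exact: (planar_separation c0 s0 cs XY h2 h4 h3).
  (* reflection in the bisector *)
  rewrite ltr0_norm// in h3 h4.
  apply: (planar_separation c0 s0 cs _ _ h4 h3); first by rewrite sqrrN.
  by rewrite mulrN opprK.
exists e, (s / c); split=> //.
- by rewrite divr_ge0// ltW.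
- by rewrite DE c0E acos_atan.
move=> p q.
have pos w : Om w -> 0 < enorm (orth_proj u w).
  by move=> Ow; rewrite enorm_gt0 (orth_proj_neq0 hOm hu Ow).
have dotk w z : dot z u = 0 -> Om w -> dot z (k w) = (enorm (orth_proj u w))^-1 * dot z w.
  move=> zu Ow; rewrite /k /shadow /normalize dotZr [dot z _]dotC dot_orth_proj.
  by rewrite [dot u z]dotC zu mulr0 subr0 [dot w z]dotC.
have fu : dot f u = 0 := dot_crossl _ _.
have eu : dot e u = 0 by rewrite dotC.
have pqu : dot (p *: e + q *: f) u = 0.
  by rewrite dotDl (dotZl p) (dotZl q) fu eu !mulr0 addr0.
have xw w : dot (p *: e + q *: f) (k w) = p * dot (k w) e + q * dot (k w) f.
  by rewrite dotDl (dotZl p) (dotZl q) (dotC e) (dotC f).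
split.
  move=> [w Ow pqw]; have := sector_in w Ow; set X := dot _ e; set Y := dot _ f.
  have : p * X + q * Y = 0 by rewrite -xw dotk// pqw mulr0.
  have : X ^+ 2 + Y ^+ 2 = 1.
    by rewrite -(kk Ow) (parseval uu ee ue) (dot_shadowu hu) expr0n/= addr0.
  move=> XY /eqP; rewrite addr_eq0 => /eqP pX sec.
  have X0 : 0 < X.
    rewrite ltNge; apply/negP => X0.
    have Y0 : Y = 0.
      apply/eqP; rewrite -normr_le0 -(pmulr_rle0 _ c0) (le_trans sec)//.
      by rewrite mulr_ge0_le0.
    have X1 : X = -1.
      move/eqP: XY; rewrite Y0 expr0n/= addr0 sqrf_eq1 => /orP[]/eqP // X1.
      by move: X0; rewrite X1 ler10.
    have a0 : 0 <= (2 * c)^-1 by rewrite invr_ge0 mulr_ge0// ltW.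
    have /eqP := shadow_comb_neq0 hOm hu Ow O1 O2 ltr01 a0 a0; apply.
    rewrite -/k [k w](frame_decomp uu ee ue) (dot_shadowu hu) scale0r addr0.
    rewrite -/X -/f -/Y X1 Y0 k1E k2E.
    by apply: comb2_eq0; field; rewrite gt_eqF.
  have pXq : `|p| * X = `|q| * `|Y|.
    by have := congr1 (fun r => `|r|) pX; rewrite normrN !normrM (gtr0_norm X0).
  rewrite mulrAC ler_pdivlMr// -(ler_pM2r X0).
  rewrite mulrAC pXq -mulrA [`|Y| * c]mulrC [leRHS]mulrAC [leRHS]mulrC.
  by apply: ler_wpM2l.
move=> pq.
set v := p *: e + q *: f.
have v1 : dot v (k w1) = p * c + q * s by rewrite xw.
have v2 : dot v (k w2) = p * c - q * s.
  by rewrite xw dot_bis_cross// dot_bis// mulrN.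
have v0 w : Om w -> dot v (k w) = 0 -> orthogonal_cone Om v.
  move=> Ow /eqP; rewrite dotk// mulf_eq0 invr_eq0 gt_eqF ?pos//= => /eqP vw.
  by exists w.
have a12 : (p * c + q * s) * (p * c - q * s) <= 0.
  rewrite (_ : _ * _ = (p * c) ^+ 2 - (q * s) ^+ 2); last by ring.
  rewrite subr_le0 -(ger0_norm (sqr_ge0 (p * c))) -(ger0_norm (sqr_ge0 (q * s))).
  rewrite !normrX ler_pXn2r ?nnegrE//.
  move: pq; rewrite mulrAC ler_pdivlMr// !normrM (gtr0_norm c0) (ger0_norm s0).
  by rewrite [s * _]mulrC.
(* v takes values of opposite signs at w1 and w2, hence vanishes at some
   combination z of them *)
have [a1|a1] := eqVneq (p * c + q * s) 0; first by apply: (v0 w1); rewrite ?v1.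
pose l := - (p * c - q * s) / (p * c + q * s).
have l0 : 0 <= l.
  rewrite /l (_ : _ / _ = - ((p * c + q * s) * (p * c - q * s)) / (p * c + q * s) ^+ 2).
    by rewrite mulr_ge0 ?oppr_ge0// invr_ge0 sqr_ge0.
  by field.
set z := (l * (enorm (orth_proj u w1))^-1) *: w1 + (enorm (orth_proj u w2))^-1 *: w2.
have Cz : cone Om z.
  apply: cone_add => //; apply: cone_scale; try exact: cone_Om.
    by rewrite mulr_ge0// invr_ge0 enorm_ge0.
  by rewrite invr_ge0 enorm_ge0.
have dotz y : dot y u = 0 -> dot y z = l * dot y (k w1) + dot y (k w2).
  by move=> yu; rewrite !dotk// /z dotDr !dotZr mulrA.
have vz : dot v z = 0.
  by rewrite dotz// v1 v2 /l; field.
have ez : 0 < dot e z.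
  rewrite dotz// ![dot e (k _)]dotC -/c dot_bis// -/c.
  by rewrite ltr_wpDl// mulr_ge0// ltW.
have [t [w [t0 Ow zE]]] := (coneP Om z).1 Cz.
have tn0 : t != 0 by apply/eqP => t_eq0; move: ez; rewrite zE t_eq0 scale0r dot0r ltxx.
exists w => //; apply/eqP; move/eqP: vz; rewrite zE dotZr mulf_eq0.
by rewrite (negbTE tn0).
Qed.

End dihedral_sector.

Section measurability.
Context {R : realType}.
Implicit Types x y z u v w e : E3 R.
Variable Om : set (E3 R).
Hypothesis hOm : spherically_convex Om.

Lemma measurable_Om : measurable Om.
Proof. by have [_ cOm _ _ _] := hOm; exact: closed_measurable_E3. Qed.

Lemma measurable_orthogonal_cone : measurable (orthogonal_cone Om).
Proof. by apply: closed_measurable_E3; exact: closed_orthogonal_cone. Qed.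

Lemma measurable_sphere : measurable (@sphere R).
Proof.
rewrite (_ : @sphere R = (@enorm R) @^-1` [set 1]) //.
rewrite -[X in measurable X]setTI.
exact: (measurable_enorm (f := id) (@measurable_id _ _ _)).
Qed.

Lemma measurable_tilde : measurable (tilde Om).
Proof.
rewrite tildeE; apply: measurableI; last exact: measurable_sphere.
exact: measurable_orthogonal_cone.
Qed.

Lemma measurable_opp3 (A : set (E3 R)) : measurable A ->
  measurable [set u | A (- u)].
Proof.
move=> mA.
have mN := measurable_oppE3 (@measurable_id _ (E3 R) setT).
by rewrite -[X in measurable X]setTI; exact: mN.
Qed.

Lemma outsideE : outside Om = @sphere R `&` ~` (Om `|` [set u | Om (- u)]).
Proof.
apply/seteqP; split=> u.
  by move=> [su nu nNu]; split=> // -[].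
by move=> [su nu]; split=> // ou; apply: nu; [left|right].
Qed.

Lemma measurable_outside : measurable (outside Om).
Proof.
rewrite outsideE; apply: measurableI; first exact: measurable_sphere.
apply/measurableC/measurableU; first exact: measurable_Om.
by apply: measurable_opp3; exact: measurable_Om.
Qed.

Lemma dihedral_bound u : outside Om u -> 0 <= dihedral Om u <= pi.
Proof.
move=> hu; have [w1 [w2 [ O1 O2 -> _]]] := dihedral_extremal hOm hu.
by have := dot_shadow_bound hOm hu O1 O2 => ?; rewrite acos_ge0// acos_lepi.
Qed.

(** Multiplying by the norms of the projections makes this a condition on
    functions that are continuous in u on the whole space. *)
Lemma dihedral_gtP u (a : R) : outside Om u -> 0 <= a <= pi ->
  a < dihedral Om u <-> exists w1 w2, [/\ Om w1, Om w2 &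
    dot (orth_proj u w1) (orth_proj u w2) -
    cos a * (enorm (orth_proj u w1) * enorm (orth_proj u w2)) < 0].
Proof.
move=> hu a0.
have [v1 [v2 [ O1 O2 DE minv]]] := dihedral_extremal hOm hu.
have acosE w1 w2 : Om w1 -> Om w2 ->
    (a < acos (dot (shadow u w1) (shadow u w2))) =
    (dot (orth_proj u w1) (orth_proj u w2) -
    cos a * (enorm (orth_proj u w1) * enorm (orth_proj u w2)) < 0).
  move=> {}O1 {}O2; have b := dot_shadow_bound hOm hu O1 O2.
  have ia : a \in `[0, pi] by rewrite in_itv/=.
  have ic : acos (dot (shadow u w1) (shadow u w2)) \in `[0, pi].
    by rewrite in_itv/= acos_ge0// acos_lepi.
  rewrite -(ltr_cos ia ic) acosK ?in_itv//=.
  have n1 : 0 < enorm (orth_proj u w1) by rewrite enorm_gt0 (orth_proj_neq0 hOm hu).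
  have n2 : 0 < enorm (orth_proj u w2) by rewrite enorm_gt0 (orth_proj_neq0 hOm hu).
  rewrite subr_lt0 -ltr_pdivrMr ?mulr_gt0//.
  congr (_ < _); rewrite /shadow /normalize.
  by rewrite (dotZl (enorm (orth_proj u w1))^-1) dotZr invfM; ring.
split=> [|[w1 [w2 [Ow1 Ow2]]]].
  by rewrite DE acosE// => h; exists v1, v2.
rewrite -acosE// DE => /lt_le_trans; apply.
have /andP[b1 _] := dot_shadow_bound hOm hu O1 O2.
have /andP[_ b2] := dot_shadow_bound hOm hu Ow1 Ow2.
by apply: le_acos => //; exact: minv.
Qed.

(** On the outside directions, the dihedral angle is lower semicontinuous:
    a supremum of angles that are continuous in u. *)
Lemma measurable_dihedral : measurable_fun (outside Om) (dihedral Om).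
Proof.
have mout := measurable_outside.
apply: (measurability _ (RGenOInfty.measurableE R)) => //.
move=> _ [_ [a ->] <-]; rewrite (_ : _ `&` _ =
    outside Om `&` [set u | a < dihedral Om u]); last first.
  by apply/seteqP; split=> u /= [hu]; rewrite in_itv/= ?andbT.
have [a0|a0] := ltP a 0.
  rewrite (_ : _ `&` _ = outside Om)//; apply/seteqP; split=> [u []//|u hu].
  split=> //=; rewrite (lt_le_trans a0)//.
  by have /andP[] := dihedral_bound hu.
have [api|api] := leP a pi; last first.
  rewrite (_ : _ `&` _ = set0)//; apply/seteqP; split=> // u [hu /=].
  apply/negP; rewrite -leNgt (le_trans _ (ltW api))//.
  by have /andP[] := dihedral_bound hu.
pose f w1 w2 u : R := dot (orth_proj u w1) (orth_proj u w2) -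
    cos a * (enorm (orth_proj u w1) * enorm (orth_proj u w2)).
rewrite (_ : _ `&` _ = outside Om `&`
    \bigcup_(p in Om `*` Om) [set u | f p.1 p.2 u < 0]); last first.
  apply/seteqP; split=> u [hu] /=.
    move/(dihedral_gtP hu); rewrite a0 api => /(_ isT)[w1 [w2 [ O1 O2 h]]].
    by split=> //; exists (w1, w2).
  move=> [[w1 w2] /= [ O1 O2] h]; split=> //.
  by apply/(dihedral_gtP hu); [rewrite a0|exists w1, w2].
apply: measurableI => //; apply: open_measurable_E3.
apply: bigcup_open => -[w1 w2] _ /=.
apply: (@open_comp _ _ (f w1 w2) [set r | r < 0]); last exact: open_lt.
move=> u _.
have cid : continuous_at u (fun u : E3 R => u) by exact: cvg_id.
have cproj w : continuous_at u (fun u => orth_proj u w).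
  by apply: continuous_at_orth_proj => //; exact: continuous_at_cst.
apply: (@continuous_atD _ _ u
  (fun u => dot (orth_proj u w1) (orth_proj u w2))
  (fun u => - (cos a * (enorm (orth_proj u w1) * enorm (orth_proj u w2))))).
  by apply: continuous_at_dot; exact: cproj.
apply: continuous_atN; apply: continuous_atM; first exact: continuous_at_cst.
by apply: continuous_atM; apply: continuous_at_enorm; exact: cproj.
Qed.

End measurability.

(** * Integration over pairs of directions *)
Section density.
Context {R : realType}.
Local Notation T1 := (measurableTypeR R).
Local Notation T2 := (T1 * T1)%type.
Local Notation mu := (@lebesgue_measure R).
Implicit Types x y z u v w e : E3 R.
Variable Om : set (E3 R).
Hypothesis hOm : spherically_convex Om.

(** The density on the unit ball that represents integration over [tilde Om]
    for functions homogeneous of degree one. *)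
Definition cone_density x : R := \1_(orthogonal_cone Om) x * radial (enorm x).

Lemma cone_density_ge0 x : 0 <= cone_density x.
Proof. by rewrite mulr_ge0// radial_ge0. Qed.

Lemma measurable_cone_density d (T : measurableType d) (f : T -> E3 R) :
  measurable_fun setT f -> measurable_fun setT (fun t => cone_density (f t)).
Proof.
move=> mf; rewrite /cone_density; apply: measurable_funM.
  by apply: measurable_fun_inset => //; exact: measurable_orthogonal_cone.
by apply: measurable_radial; exact: measurable_enorm.
Qed.

(** For x in the punctured ball, x / |x| belongs to [tilde Om] exactly when x is
    orthogonal to a point of Om, and F(x / |x|) = F(x) / |x|. *)
Lemma integral_tilde (F : E3 R -> \bar R) : measurable_fun setT F ->
  (forall x, 0 <= F x)%E ->
  (forall t x, 0 < t -> F (t *: x) = (t%:E * F x)%E) ->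
  (\int[surface]_(w in tilde Om) F w =
   3%:E * \int[lebesgue3]_x ((cone_density x)%:E * F x))%E.
Proof.
move=> mF F0 FZ.
have mA := measurable_tilde hOm.
transitivity (\int[surface]_w ((\1_(tilde Om) w)%:E * F w))%E.
  rewrite integral_mkcond; apply: eq_integral => w _.
  by rewrite patchE indicE; case: ifPn => _; rewrite ?mul1e ?mul0e.
rewrite integral_surface; last 2 first.
- apply: emeasurable_funM => //; apply/measurable_EFinP.
  exact: measurable_indic.
- by move=> w; rewrite mule_ge0.
congr (_ * _)%E; apply: eq_integral => x _.
have [xB|xB] := boolP (x \in @punctured_ball R); last first.
  rewrite indicE (negbTE xB) mul0e /cone_density.
  suff -> : radial (enorm x) = 0 by rewrite mulr0 mul0e.
  rewrite /radial indicE memNset ?mul0r//= in_itv/= => xB'.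
  by move/negP: xB; apply; rewrite inE.
have /andP[x0 x1] : 0 < enorm x <= 1 by move: xB; rewrite inE.
have xn0 : x != 0 by rewrite -enorm_gt0.
rewrite indicE xB mul1e /normalize FZ ?invr_gt0// muleA -EFinM.
congr (_%:E * _)%E; rewrite /cone_density.
have -> : radial (enorm x) = (enorm x)^-1.
  by rewrite /radial indicE mem_set ?mul1r//= in_itv/= x0.
rewrite !indicE.
congr ((nat_of_bool _)%:R * _); apply/idP/idP; rewrite !inE tildeE.
  by move=> [/orthogonal_coneZ + _]; apply; rewrite invr_eq0 gt_eqF.
move=> Zx; split; last exact: enorm_normalize.
by apply/orthogonal_coneZ => //; rewrite invr_eq0 gt_eqF.
Qed.

Lemma det3E x y z : det3 x y z = dot (cross x y) z.
Proof.
rewrite /det3 (expand_det_row _ ord0) !big_ord_recl big_ord0.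
rewrite /cofactor !(expand_det_row _ ord0) !big_ord_recl !big_ord0.
by rewrite /cofactor !det_mx11 !mxE/= /dot/= /bump/=; ring.
Qed.

(** Extended by zero, so as to be measurable on the whole space. *)
Definition dihedral_gap u : R :=
  \1_(outside Om) u * (dihedral Om u ^+ 2 - sin (dihedral Om u) ^+ 2).

(** The integral of sin^2(s - t) over pairs of directions orthogonal to u, of
    polar angles s and t, that belong to [tilde Om]: these directions form the
    whole circle if u or -u is in Om, and two opposite arcs of length D
    otherwise. *)
Definition plane_weight u : R :=
  2 * pi ^+ 2 * (\1_Om u + \1_Om (- u)) + 2 * dihedral_gap u.

(** Up to a positive factor, this is the second moment of a sector. *)
Lemma sector_gap (T : R) : 0 <= T -> 0 <= 2 * atan T - sin (2 * atan T).
Proof.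
move=> T0; rewrite sin_atan2 -mulrBr mulr_ge0//.
rewrite -(@pmulr_rge0 _ (2 / 3)) ?divr_gt0// -lee_fin -sector_moment1//.
apply: integral_ge0 => p _; rewrite lee_fin; apply: mulr_ge0; first exact: sqr_ge0.
by apply: mulr_ge0; [rewrite indicE|exact: radial_ge0].
Qed.

Lemma dihedral_sqr_gap u : outside Om u ->
  0 <= dihedral Om u ^+ 2 - sin (dihedral Om u) ^+ 2.
Proof.
move=> hu; have [e [T [_ _ T0 DE _]]] := sector_frame hOm hu.
have /andP[D0 Dpi] := dihedral_bound hOm hu.
rewrite subr_sqr; apply: mulr_ge0; first by rewrite DE sector_gap.
by rewrite addr_ge0// sin_ge0_pi// D0.
Qed.

Lemma dihedral_gap_ge0 u : 0 <= dihedral_gap u.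
Proof.
rewrite /dihedral_gap indicE; case: (boolP (_ \in _)); rewrite ?mul0r// inE => hu.
by rewrite mul1r dihedral_sqr_gap.
Qed.

Lemma plane_weight_ge0 u : 0 <= plane_weight u.
Proof.
rewrite /plane_weight addr_ge0//.
  by apply: mulr_ge0; [rewrite mulr_ge0// sqr_ge0|rewrite addr_ge0// indicE].
by rewrite mulr_ge0// dihedral_gap_ge0.
Qed.

Lemma Om_opp_disj u : Om u -> ~ Om (- u).
Proof.
move=> Ou ONu; have u0 : u = 0.
  by apply: (cone_pointed hOm (cone_Om Ou) (cone_Om ONu)); exact: subrr.
by have /eqP := Om_dot1 hOm Ou; rewrite u0 dot0l eq_sym oner_eq0.
Qed.

Lemma plane_weight_outside u : outside Om u ->
  plane_weight u = 2 * (dihedral Om u ^+ 2 - sin (dihedral Om u) ^+ 2).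
Proof.
move=> hu; have [_ nu nNu] := hu.
rewrite /plane_weight /dihedral_gap !indicE (memNset nu) (memNset nNu) (mem_set hu).
by rewrite addr0 mulr0 add0r mul1r.
Qed.

Lemma plane_weight_inside u : Om u \/ Om (- u) -> plane_weight u = 2 * pi ^+ 2.
Proof.
have one v : Om v -> \1_Om v + \1_Om (- v) = 1 :> R.
  move=> Ov; rewrite !indicE (mem_set Ov) memNset ?addr0//.
  exact: Om_opp_disj.
move=> Ou; rewrite /plane_weight /dihedral_gap [\1_(outside Om) u]indicE memNset; last first.
  by move=> [_ nu nNu]; case: Ou.
rewrite mul0r mulr0 addr0; case: Ou => [|ONu]; first by move/one ->; rewrite mulr1.
by have := one _ ONu; rewrite opprK addrC => ->; rewrite mulr1.
Qed.

Lemma outside_opp u : outside Om (- u) <-> outside Om u.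
Proof.
have sN v : sphere v -> sphere (- v).
  by rewrite /sphere/= /enorm dotNl dotNr opprK.
have outN v : outside Om v -> outside Om (- v).
  by move=> [sv nv nNv]; split; [exact: sN| |rewrite opprK].
by split=> [/outN|/outN //]; rewrite opprK.
Qed.

Lemma plane_weight_opp u : plane_weight (- u) = plane_weight u.
Proof.
rewrite /plane_weight /dihedral_gap opprK [\1_Om (- u) + _]addrC; congr (_ + _ * (_ * _)).
  rewrite !indicE; congr (nat_of_bool _)%:R.
  by apply/idP/idP; rewrite !inE => /outside_opp.
suff -> : dihedral Om (- u) = dihedral Om u by [].
rewrite /dihedral; congr (opening_angle (_ @` _)); apply/funext => w.
by rewrite /orth_proj dotNr scalerN scaleNr opprK.
Qed.

Lemma measurable_dihedral_gap : measurable_fun setT dihedral_gap.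
Proof.
have mout := measurable_outside hOm; have mD := measurable_dihedral hOm.
pose h u := dihedral Om u ^+ 2 - sin (dihedral Om u) ^+ 2.
rewrite (_ : dihedral_gap = h \_ (outside Om)); last first.
  apply/funext => u; rewrite patchE /dihedral_gap indicE.
  by case: ifPn => _; rewrite ?mul1r ?mul0r.
apply/(measurable_restrict _ mout measurableT); rewrite setTI.
apply: measurable_funB; apply: measurable_funX => //.
apply: (@measurableT_comp _ _ _ _ _ _ (@sin R)) => //.
by apply: continuous_measurable_fun; exact: continuous_sin.
Qed.

Lemma measurable_plane_weight d (T : measurableType d) (f : T -> E3 R) :
  measurable_fun setT f -> measurable_fun setT (fun t => plane_weight (f t)).
Proof.
have mOm := measurable_Om hOm; have mgap := measurable_dihedral_gap.
move=> mf; suff mw : measurable_fun setT plane_weight by exact: measurableT_comp.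
have mN : measurable_fun setT (fun u => \1_Om (- u) : R).
  rewrite (_ : (fun u => _) = \1_[set u | Om (- u)]).
    by apply: measurable_indic; exact: measurable_opp3.
  by apply/funext => u; rewrite !indicE; congr (nat_of_bool _)%:R.
apply: measurable_funD; apply: measurable_funM => //.
by apply: measurable_funD => //; exact: measurable_indic.
Qed.

Lemma cross_perp_lift (c p q : T2) :
  cross (perp_lift c p) (perp_lift c q) = wedge p q *: chart c.
Proof. by apply: eq3; rewrite /= /GRing.scale/= /wedge; ring. Qed.

Lemma perp_liftE (c : T2) x : dot x (chart c) = 0 -> x = perp_lift c x.1.
Proof.
rewrite /dot/= mulr1 => /eqP; rewrite addrC addr_eq0 => /eqP xE.
by apply: eq3 => //=; rewrite xE; ring.
Qed.

(** In the coordinates (p.1, p.2) of the orthonormal basis e, u x e, the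
    horizontal projection scales areas by 1 / slant.  This factor appears twice
    from the substitutions in p and q, and twice from the square of the
    wedge. *)
Lemma integral_plane_sector (c : T2) e (k : T2 -> R) (a b : R) :
  let u := normalize (chart c) in
  dot e e = 1 -> dot u e = 0 ->
  (forall p, cone_density (p.1 *: e + p.2 *: cross u e) = k p) ->
  (forall r s, k (r, - s) = k (r, s)) ->
  (\int[area]_p (p.1 ^+ 2 * k p)%:E = a%:E)%E ->
  (\int[area]_p (p.2 ^+ 2 * k p)%:E = b%:E)%E ->
  (\int[area]_p \int[area]_q
     (wedge p q ^+ 2 * (cone_density (perp_lift c p) * cone_density (perp_lift c q)))%:E =
   (slant c ^- 4 * (2 * a * b))%:E)%E.
Proof.
move=> u ee ue kE kN Ia Ib.
have uu : dot u u = 1 by apply: dot_normalize; exact: chart_neq0.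
pose f := cross u e.
have s0 := slant_gt0 c.
have d_E : e.1.1 * f.1.2 - f.1.1 * e.1.2 = (slant c)^-1.
  rewrite [f.1.1 * _]mulrC (frame_det ee ue) /u /normalize /=.
  by rewrite [LHS]mulr1.
have d0 : e.1.1 * f.1.2 - f.1.1 * e.1.2 != 0.
  by rewrite d_E invr_eq0 gt_eqF.
pose P (p : T2) : T2 :=
  (e.1.1 * p.1 + f.1.1 * p.2, e.1.2 * p.1 + f.1.2 * p.2).
have liftP p : perp_lift c (P p) = p.1 *: e + p.2 *: f.
  rewrite [RHS](@perp_liftE c); last first.
    have ch : chart c = slant c *: u.
      by rewrite /u /normalize scalerA mulfV ?scale1r// gt_eqF.
    have fu : dot f u = 0 := dot_crossl _ _.
    have eu : dot e u = 0 by rewrite dotC.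
    by rewrite ch dotZr dotDl (dotZl p.1) (dotZl p.2) fu eu !mulr0 addr0 mulr0.
  by congr perp_lift; congr pair; rewrite /= /GRing.scale/=; ring.
have wedgeP p q : wedge (P p) (P q) = (slant c)^-1 * wedge p q.
  by rewrite -d_E /wedge/=; ring.
have mP : measurable_fun setT P by rewrite /P; msr.
have mk : measurable_fun setT k.
  rewrite (_ : k = fun p => cone_density (perp_lift c (P p))); last first.
    by apply/funext => p; rewrite liftP kE.
  apply: measurable_cone_density; apply: measurable_perp_lift; first exact: measurable_cst.
  exact: mP.
have k0 p : 0 <= k p by rewrite -kE cone_density_ge0.
pose G (p q : T2) := (wedge p q ^+ 2 *
  (cone_density (perp_lift c p) * cone_density (perp_lift c q)))%:E.
have G0 p q : (0 <= G p q)%E.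
  rewrite lee_fin; apply: mulr_ge0; first exact: sqr_ge0.
  by apply: mulr_ge0; exact: cone_density_ge0.
have mG d (T : measurableType d) (g h : T -> T2) : measurable_fun setT g ->
    measurable_fun setT h -> measurable_fun setT (fun t => G (g t) (h t)).
  move=> mg mh; apply/measurable_EFinP; apply: measurable_funM.
    by apply: measurable_funX; exact: measurable_wedge.
  by apply: measurable_funM; apply: measurable_cone_density; apply: measurable_perp_lift.
rewrite -(integral_plane_linear d0 (f := fun p => \int[area]_q G p q)%E); last 2 first.
- apply: (measurable_fun_integral area (f := G)) => //.
  by apply: mG; msr.
- by move=> p; exact: integral_ge0.
have sV : 0 <= (slant c)^-1 by rewrite invr_ge0 ltW.
have sV3 : 0 <= slant c ^- 3 by rewrite invr_ge0 exprn_ge0// ltW.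
have mGP p : measurable_fun setT (fun q => G (P p) (P q)).
  exact: (mG _ _ (cst (P p)) P).
have K0 p q : (0 <= (wedge p q ^+ 2 * (k p * k q))%:E)%E by nonneg.
have mK p : measurable_fun setT (fun q => (wedge p q ^+ 2 * (k p * k q))%:E).
  apply/measurable_EFinP; apply: measurable_funM; last by msr.
  by apply: measurable_funX; exact: (measurable_wedge (f := cst p)).
rewrite d_E gtr0_norm ?invr_gt0//.
transitivity ((slant c)^-1%:E * \int[area]_p ((slant c ^- 3)%:E *
  \int[area]_q (wedge p q ^+ 2 * (k p * k q))%:E))%E.
  congr (_ * _)%E; apply: eq_integral => p _.
  rewrite -(integral_plane_linear d0 (f := G (P p))) //; last first.
    exact: (mG _ _ (cst (P p))).
  rewrite d_E gtr0_norm ?invr_gt0//.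
  rewrite -(ge0_integralZl_area (mGP p) (fun q => G0 (P p) (P q)) sV).
  rewrite -(ge0_integralZl_area (mK p) (K0 p) sV3).
  apply: eq_integral => q _; rewrite /G -!EFinM; congr EFin.
  by rewrite -/(P p) -/(P q) wedgeP !liftP !kE; field; rewrite gt_eqF.
have mI : measurable_fun setT (fun p : T2 =>
    \int[area]_q (wedge p q ^+ 2 * (k p * k q))%:E)%E.
  apply: (measurable_fun_integral area
    (f := fun p q => (wedge p q ^+ 2 * (k p * k q))%:E)) => //.
  apply/measurable_EFinP; apply: measurable_funM; last by msr.
  by apply: measurable_funX; apply: measurable_wedge; msr.
have I0 p : (0 <= \int[area]_q (wedge p q ^+ 2 * (k p * k q))%:E)%E.
  by apply: integral_ge0 => q _; exact: K0.
rewrite (ge0_integralZl_area mI I0 sV3).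
rewrite (integral_wedge_sqr mk k0 kN Ia Ib) -!EFinM; congr EFin.
by field; rewrite gt_eqF.
Qed.

Lemma integral_plane_weight (c : T2) :
  (\int[area]_p \int[area]_q
     (wedge p q ^+ 2 * (cone_density (perp_lift c p) * cone_density (perp_lift c q)))%:E =
   (slant c ^- 4 * (plane_weight (normalize (chart c)) / 9))%:E)%E.
Proof.
set u := normalize (chart c).
have uu : dot u u = 1 by apply: dot_normalize; exact: chart_neq0.
have su : sphere u by rewrite /sphere/= enorm_normalize// chart_neq0.
have enormE e p : dot e e = 1 -> dot u e = 0 ->
    enorm (p.1 *: e + p.2 *: cross u e) = pnorm p.
  move=> ee ue; rewrite /enorm dot_comb2 -?expr2//.
  - exact: frame_ff.
  - exact: dot_crossr.
have [hu|hu] := pselect (outside Om u); last first.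
  have Ou : Om u \/ Om (- u).
    by apply: contrapT => nO; apply: hu; split=> // ?; apply: nO; [left|right].
  rewrite plane_weight_inside//.
  have [e [ee ue]] : exists e, dot e e = 1 /\ dot u e = 0.
    pose x : E3 R := ((u.2, 0), - u.1.1).
    have x0 : x != 0.
      apply/eqP => /(congr1 fst)/(congr1 fst)/=; rewrite /u /normalize/=.
      move/eqP; rewrite mulf_eq0 oner_eq0 orbF invr_eq0 gt_eqF//.
      exact: slant_gt0.
    exists (normalize x); split; first exact: dot_normalize.
    by rewrite /normalize dotZr (_ : dot u x = 0) ?mulr0// /dot/=; ring.
  rewrite (integral_plane_sector (k := fun p => radial (pnorm p)) ee ue _ _
    plane_moment1 plane_moment2).
  - by congr EFin; field; rewrite gt_eqF// slant_gt0.
  - move=> p; rewrite /cone_density enormE// indicE mem_set ?mul1r//.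
    have perp x : dot x u = 0 -> orthogonal_cone Om x.
      move=> xu; case: Ou => [Ou|Ou]; first by exists u.
      by exists (- u) => //; rewrite dotNr xu oppr0.
    apply: perp; have fu : dot (cross u e) u = 0 := dot_crossl _ _.
    by rewrite dotDl !dotZl [dot e u]dotC ue fu !mulr0 addr0.
  - by move=> x y; rewrite /pnorm/= sqrrN.
rewrite plane_weight_outside//.
have [e [T [ee ue T0 DE secE]]] := sector_frame hOm hu.
rewrite (integral_plane_sector (k := fun p => \1_(sector T) p * radial (pnorm p))
  ee ue _ _ (sector_moment1 T0) (sector_moment2 T0)).
- rewrite DE sin_atan2; congr EFin; field.
  rewrite !gt_eqF ?slant_gt0//=.
  by rewrite ltr_wpDr// sqr_ge0.
- move=> p; rewrite /cone_density enormE//; congr (_ * _); rewrite !indicE.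
  by congr (nat_of_bool _)%:R; apply/idP/idP; rewrite !inE => /secE.
- move=> x y; rewrite /pnorm/= sqrrN; congr (_ * _); rewrite !indicE.
  by congr (nat_of_bool _)%:R; apply/idP/idP; rewrite !inE /sector/= normrN.
Qed.

Lemma measurable_cross d (T : measurableType d) (f g : T -> E3 R) :
  measurable_fun setT f -> measurable_fun setT g ->
  measurable_fun setT (fun t => cross (f t) (g t)).
Proof. by move=> mf mg; rewrite /cross; msr. Qed.

Lemma measurable_absdet d (T : measurableType d) (f g h : T -> E3 R) :
  measurable_fun setT f -> measurable_fun setT g -> measurable_fun setT h ->
  measurable_fun setT (fun t => `|det3 (f t) (g t) (h t)|).
Proof.
move=> mf mg mh.
rewrite (_ : (fun t => _) = fun t => `|dot (cross (f t) (g t)) (h t)|); last first.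
  by apply/funext => t; rewrite det3E.
apply: (measurableT_comp (@normr_measurable _ _)).
by apply: measurable_dot => //; exact: measurable_cross.
Qed.

Lemma absdetZl (t : R) x y z : 0 < t -> `|det3 (t *: x) y z| = t * `|det3 x y z|.
Proof.
move=> t0; rewrite !det3E (_ : cross (t *: x) y = t *: cross x y).
  by rewrite dotZl normrM gtr0_norm.
by apply: eq3; rewrite /= /GRing.scale/=; ring.
Qed.

Lemma absdetZr (t : R) x y z : 0 < t -> `|det3 x (t *: y) z| = t * `|det3 x y z|.
Proof.
move=> t0; rewrite !det3E (_ : cross x (t *: y) = t *: cross x y).
  by rewrite dotZl normrM gtr0_norm.
by apply: eq3; rewrite /= /GRing.scale/=; ring.
Qed.

(** The determinant of v with two vectors of the plane orthogonal to (c, 1) is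
    their wedge times <(c, 1), v>; the Jacobian of [integral_pencil] provides the
    other factor of the squared wedge. *)
Lemma integral_det_density v :
  (\int[lebesgue3]_x \int[lebesgue3]_y
     (cone_density x * (cone_density y * `|det3 x y v|))%:E =
   \int[area]_c (slant c ^- 4 * (plane_weight (normalize (chart c)) / 9) *
      `|dot (chart c) v|)%:E)%E.
Proof.
pose G (xy : E3 R * E3 R) :=
  (cone_density xy.1 * (cone_density xy.2 * `|det3 xy.1 xy.2 v|))%:E.
have G0 xy : (0 <= G xy)%E.
  by rewrite lee_fin; apply: mulr_ge0; [|apply: mulr_ge0 => //]; exact: cone_density_ge0.
have mG : measurable_fun setT G.
  apply/measurable_EFinP; apply: measurable_funM.
    by apply: measurable_cone_density; msr.
  apply: measurable_funM; first by apply: measurable_cone_density; msr.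
  by apply: measurable_absdet; msr.
rewrite -[LHS]/(\int[lebesgue3]_x \int[lebesgue3]_y G (x, y))%E.
rewrite integral_pencil//; apply: eq_integral => c _.
rewrite EFinM muleC -integral_plane_weight.
pose K (p q : T2) := (wedge p q ^+ 2 *
  (cone_density (perp_lift c p) * cone_density (perp_lift c q)))%:E.
have K0 p q : (0 <= K p q)%E.
  rewrite lee_fin; apply: mulr_ge0; first exact: sqr_ge0.
  by apply: mulr_ge0; exact: cone_density_ge0.
have mK d (T : measurableType d) (g h : T -> T2) : measurable_fun setT g ->
    measurable_fun setT h -> measurable_fun setT (fun t => K (g t) (h t)).
  move=> mg mh; apply/measurable_EFinP; apply: measurable_funM.
    by apply: measurable_funX; exact: measurable_wedge.
  by apply: measurable_funM; apply: measurable_cone_density; apply: measurable_perp_lift.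
have mK1 p : measurable_fun setT (K p) by exact: (mK _ _ (cst p)).
have mI : measurable_fun setT (fun p : T2 => \int[area]_q K p q)%E.
  by apply: (measurable_fun_integral area (f := K)) => //; apply: mK; msr.
have I0 p : (0 <= \int[area]_q K p q)%E by apply: integral_ge0 => q _.
rewrite -(ge0_integralZl_area mI I0 (normr_ge0 _)).
apply: eq_integral => p _.
rewrite -(ge0_integralZl_area (mK1 p) (K0 p) (normr_ge0 _)).
apply: eq_integral => q _; rewrite /G /K -!EFinM; congr EFin => /=.
rewrite det3E cross_perp_lift dotZl normrM -[wedge p q ^+ 2]ger0_norm ?sqr_ge0//.
by rewrite normrX; ring.
Qed.

(** The constant is 9 / 9 / 2: each integral over the sphere is three times an
    integral over the ball, the planar integral is [plane_weight] / 9, and the chart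
    covers the sphere twice. *)
Lemma integral_det_pair v :
  (\int[surface]_(v1 in tilde Om) \int[surface]_(v2 in tilde Om)
     `|det3 v1 v2 v|%:E =
   (2^-1)%:E * \int[surface]_u (plane_weight u * `|dot u v|)%:E)%E.
Proof.
have mdet2 x : measurable_fun setT (fun y => (`|det3 x y v|)%:E).
  by apply/measurable_EFinP; apply: (measurable_absdet (f := cst x) (h := cst v)).
have msdet x : measurable_fun setT (fun y => (cone_density y * `|det3 x y v|)%:E).
  apply/measurable_EFinP; apply: measurable_funM.
    exact: (measurable_cone_density (f := id)).
  by apply: (measurable_absdet (f := cst x) (h := cst v)).
have sdet0 x y : (0 <= (cone_density y * `|det3 x y v|)%:E)%E.
  by rewrite lee_fin mulr_ge0// cone_density_ge0.
pose F x := (\int[lebesgue3]_y (cone_density y * `|det3 x y v|)%:E)%E.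
have F0 x : (0 <= F x)%E by apply: integral_ge0.
have mF : measurable_fun setT F.
  apply: (@measurable_fun_integral _ _ (E3 R) (E3 R) R (sf_product area mu)
    (fun x y => (cone_density y * `|det3 x y v|)%:E)) => //.
  apply/measurable_EFinP; apply: measurable_funM.
    by apply: measurable_cone_density; msr.
  by apply: measurable_absdet; msr.
transitivity (\int[surface]_(v1 in tilde Om) (3%:E * F v1))%E.
  apply: eq_integral => x _; rewrite integral_tilde//.
  by move=> t y t0; rewrite absdetZr// EFinM.
rewrite integral_tilde; last 3 first.
- by apply: emeasurable_funM.
- by move=> x; rewrite mule_ge0.
- move=> t x t0; rewrite muleCA; congr (_ * _)%E; rewrite /F.
  rewrite -ge0_integralZl//; last by rewrite lee_fin ltW.
  by apply: eq_integral => y _; rewrite absdetZl// -EFinM; congr EFin; ring.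
transitivity (9%:E * \int[lebesgue3]_x \int[lebesgue3]_y
     (cone_density x * (cone_density y * `|det3 x y v|))%:E)%E.
  have msF : measurable_fun setT (fun x => (cone_density x)%:E * F x)%E.
    apply: emeasurable_funM => //; apply/measurable_EFinP.
    exact: (measurable_cone_density (f := id)).
  have sF0 x : (0 <= (cone_density x)%:E * F x)%E.
    by rewrite mule_ge0// lee_fin cone_density_ge0.
  transitivity (3%:E * (3%:E * \int[lebesgue3]_x ((cone_density x)%:E * F x)))%E.
    congr (_ * _)%E; rewrite -ge0_integralZl//.
    by apply: eq_integral => x _; rewrite muleCA.
  rewrite muleA -EFinM (_ : 3 * 3 = 9 :> R); last by ring.
  congr (_ * _)%E; apply: eq_integral => x _.
  rewrite /F -ge0_integralZl//; last by rewrite lee_fin cone_density_ge0.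
rewrite integral_det_density integral_surface_chart; last 3 first.
- apply/measurable_EFinP; apply: measurable_funM.
    exact: (measurable_plane_weight (f := id)).
  by apply: (measurableT_comp (@normr_measurable _ _)); apply: measurable_dot.
- by move=> u; rewrite lee_fin mulr_ge0// plane_weight_ge0.
- by move=> u; rewrite plane_weight_opp dotNl normrN.
have mint : measurable_fun setT (fun c : T2 => slant c ^- 4 *
    (plane_weight (normalize (chart c)) / 9) * `|dot (chart c) v|).
  have mch : measurable_fun setT (fun c : T2 => chart c).
    exact: (measurable_chart (f := id)).
  have msl : measurable_fun setT (fun c : T2 => slant c).
    exact: measurable_enorm.
  apply: measurable_funM; last first.
    apply: (measurableT_comp (@normr_measurable _ _)).
    exact: (measurable_dot (g := cst v)).
  apply: measurable_funM; first by msr.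
  by apply: measurable_funM => //; apply: measurable_plane_weight; exact: measurable_normalize.
have int0 (c : T2) : 0 <= slant c ^- 4 *
    (plane_weight (normalize (chart c)) / 9) * `|dot (chart c) v|.
  have s0 := slant_gt0 c.
  by rewrite !mulr_ge0 ?invr_ge0 ?exprn_ge0 ?plane_weight_ge0// ltW.
rewrite -ge0_integralZl//; last 2 first.
- exact/measurable_EFinP.
- by move=> c _; rewrite lee_fin.
have mint2 : measurable_fun setT (fun c : T2 => (2 * slant c ^- 3)%:E *
    (plane_weight (normalize (chart c)) * `|dot (normalize (chart c)) v|)%:E)%E.
  have mch : measurable_fun setT (fun c : T2 => chart c).
    exact: (measurable_chart (f := id)).
  have msl : measurable_fun setT (fun c : T2 => slant c).
    exact: measurable_enorm.
  have mn : measurable_fun setT (fun c : T2 => normalize (chart c)).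
    exact: measurable_normalize.
  apply: emeasurable_funM; first by msr.
  apply/measurable_EFinP; apply: measurable_funM; first exact: measurable_plane_weight.
  apply: (measurableT_comp (@normr_measurable _ _)).
  exact: (measurable_dot (g := cst v)).
have int20 (c : T2) : (0 <= (2 * slant c ^- 3)%:E *
    (plane_weight (normalize (chart c)) * `|dot (normalize (chart c)) v|)%:E)%E.
  have s0 := slant_gt0 c.
  by rewrite -EFinM lee_fin !mulr_ge0 ?invr_ge0 ?exprn_ge0 ?plane_weight_ge0// ltW.
rewrite -ge0_integralZl//.
apply: eq_integral => c _; rewrite -!EFinM; congr EFin.
rewrite [in RHS]/normalize dotZl normrM ger0_norm ?invr_ge0 ?enorm_ge0//.
rewrite -/(normalize (chart c)) -/(slant c); field.
by rewrite gt_eqF// slant_gt0.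
Qed.

End density.

(** * Tonelli's theorem on rectangles and central symmetry *)
Section restricted_integrals.
Local Open Scope ereal_scope.
Context {R : realType}.

Lemma integral_indic_mul d (T : measurableType d)
    (m : {measure set T -> \bar R}) (D : set T) (f : T -> R) :
  \int[m]_(x in D) (f x)%:E = \int[m]_x (\1_D x * f x)%:E.
Proof.
rewrite integral_mkcond; apply: eq_integral => x _.
by rewrite patchE indicE; case: ifPn => _; rewrite ?mul1r ?mul0r.
Qed.

Lemma indicX d1 d2 (T1 : measurableType d1) (T2 : measurableType d2)
    (A : set T1) (B : set T2) p :
  \1_(A `*` B) p = (\1_A p.1 * \1_B p.2 : R)%R.
Proof. by rewrite !indicE in_setX -natrM mulnb. Qed.

Section rectangle.
Context d1 d2 (T1 : measurableType d1) (T2 : measurableType d2).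
Variables (m1 : {sigma_finite_measure set T1 -> \bar R})
          (m2 : {sigma_finite_measure set T2 -> \bar R}).
Variables (A : set T1) (B : set T2) (f : T1 * T2 -> R).
Hypothesis mf :
  measurable_fun setT (fun p => \1_A p.1 * \1_B p.2 * f p)%R.
Hypothesis f0 : forall p, (0 <= \1_A p.1 * \1_B p.2 * f p)%R.

Let rectangleE : \int[m1 \x m2]_(p in A `*` B) (f p)%:E =
  \int[m1 \x m2]_p (\1_A p.1 * \1_B p.2 * f p)%:E.
Proof.
by rewrite integral_indic_mul; apply: eq_integral => p _; rewrite indicX.
Qed.

Lemma integral_rectangle1 : \int[m1 \x m2]_(p in A `*` B) (f p)%:E =
  \int[m1]_(x in A) \int[m2]_(y in B) (f (x, y))%:E.
Proof.
rewrite rectangleE fubini_tonelli1; last 2 first.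
- exact/measurable_EFinP.
- by move=> p; rewrite lee_fin.
rewrite [RHS]integral_mkcond; apply: eq_integral => x _.
rewrite patchE /fubini_F/= indicE; case: ifPn => xA.
  by rewrite [RHS]integral_indic_mul; apply: eq_integral => y _; rewrite mul1r.
by rewrite integral0_eq// => y _; rewrite !mul0r.
Qed.

Lemma integral_rectangle2 : \int[m1 \x m2]_(p in A `*` B) (f p)%:E =
  \int[m2]_(y in B) \int[m1]_(x in A) (f (x, y))%:E.
Proof.
rewrite rectangleE fubini_tonelli2; last 2 first.
- exact/measurable_EFinP.
- by move=> p; rewrite lee_fin.
rewrite [RHS]integral_mkcond; apply: eq_integral => y _.
rewrite patchE /fubini_G/= [\1_B y]indicE; case: ifPn => yB.
  by rewrite [RHS]integral_indic_mul; apply: eq_integral => x _; rewrite mulr1.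
by rewrite integral0_eq// => x _; rewrite mulr0 mul0r.
Qed.
End rectangle.

Lemma integral_opp_lebesgue3 (f : E3 R -> \bar R) :
  measurable_fun setT f -> (forall x, 0 <= f x) ->
  \int[lebesgue3]_x f (- x)%R = \int[lebesgue3]_x f x.
Proof.
move=> mf f0.
have mN : measurable_fun setT (fun x : E3 R => f (- x)%R).
  by apply: (measurableT_comp mf); exact: measurable_oppE3.
rewrite [RHS](integral_lebesgue3 mf f0) (integral_lebesgue3 mN) => [|x]; last exact: f0.
have d0 : (- 1 * - 1 - 0 * 0 != 0 :> R)%R by rewrite mulrNN mulr1 mul0r subr0 oner_neq0.
have mg : measurable_fun setT
    (fun p => \int[@lebesgue_measure R]_t f (p, t)).
  apply: (measurable_fun_integral _ (f := fun p t => f (p, t))) => //.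
  by msr.
rewrite -(integral_plane_linear d0 mg) => [|p]; last exact: integral_ge0.
rewrite mulrNN mulr1 mul0r subr0 normr1 mul1e.
apply: eq_integral => p _.
rewrite -[RHS](@integral_affine _ (-1) 0); first last.
- by move=> t; exact: f0.
- exact: measurableT_comp.
- by rewrite oppr_eq0 oner_neq0.
rewrite normrN normr1 mul1e; apply: eq_integral => t _.
congr f; apply: eq3; rewrite /=; ring.
Qed.

Lemma normalizeN (x : E3 R) : normalize (- x)%R = (- normalize x)%R.
Proof. by rewrite /normalize /enorm dotNl dotNr opprK scalerN. Qed.

Lemma integral_opp_surface (f : E3 R -> \bar R) :
  measurable_fun setT f -> (forall x, 0 <= f x) ->
  \int[surface]_u f (- u)%R = \int[surface]_u f u.
Proof.
move=> mf f0.
have mN : measurable_fun setT (fun x : E3 R => f (- x)%R).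
  by apply: (measurableT_comp mf); exact: measurable_oppE3.
rewrite integral_surface// [RHS]integral_surface//; congr (_ * _).
rewrite -[RHS]integral_opp_lebesgue3; last 2 first.
- apply: emeasurable_funM.
    by apply/measurable_EFinP; apply: measurable_indic; exact: measurable_punctured_ball.
  by apply: (measurableT_comp mf); exact: (measurable_normalize (f := id)).
- by move=> x; rewrite mule_ge0.
apply: eq_integral => x _; rewrite normalizeN; congr (_%:E * _)%E.
rewrite !indicE; congr (nat_of_bool _)%:R.
by apply/idP/idP; rewrite !inE /punctured_ball/= /enorm dotNl dotNr opprK.
Qed.

End restricted_integrals.

(** * The identity between the three functionals *)
Section crofton.
Context {R : realType}.
Implicit Types u v w : E3 R.
Variable Om : set (E3 R).
Hypothesis hOm : spherically_convex Om.

Let mA := measurable_tilde hOm.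
Let mOm := measurable_Om hOm.
Let mout := measurable_outside hOm.
Let mgap := measurable_dihedral_gap hOm.

(* The contributions to the integral over u of the points of Om and of
   the outside directions. *)
Let inside v : \bar R := (\int[surface]_u (\1_Om u * `|dot u v|)%:E)%E.
Let around v : \bar R := (\int[surface]_u (dihedral_gap Om u * `|dot u v|)%:E)%E.

Let mabsdot d (T : measurableType d) (f g : T -> E3 R) :
  measurable_fun setT f -> measurable_fun setT g ->
  measurable_fun setT (fun t => `|dot (f t) (g t)|).
Proof.
move=> mf mg; apply: (measurableT_comp (@normr_measurable _ _)).
exact: measurable_dot.
Qed.

Let minside : measurable_fun setT inside.
Proof.
apply: (@measurable_fun_integral _ _ _ _ R surface
  (fun v u => (\1_Om u * `|dot u v|)%:E)) => [|v u]; last by rewrite lee_fin mulr_ge0.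
apply/measurable_EFinP; apply: measurable_funM; first by msr.
by apply: mabsdot; msr.
Qed.

Let maround : measurable_fun setT around.
Proof.
apply: (@measurable_fun_integral _ _ _ _ R surface
  (fun v u => (dihedral_gap Om u * `|dot u v|)%:E)) => [|v u].
  apply/measurable_EFinP; apply: measurable_funM; last by apply: mabsdot; msr.
  by apply: (measurableT_comp mgap); msr.
by rewrite lee_fin mulr_ge0// dihedral_gap_ge0.
Qed.

Let inside_ge0 v : (0 <= inside v)%E.
Proof. by apply: integral_ge0 => u _; rewrite lee_fin mulr_ge0. Qed.

Let around_ge0 v : (0 <= around v)%E.
Proof. by apply: integral_ge0 => u _; rewrite lee_fin mulr_ge0// dihedral_gap_ge0. Qed.

Let integral_plane_weight_dot v :
  (\int[surface]_u (plane_weight Om u * `|dot u v|)%:E =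
   (4 * pi ^+ 2)%:E * inside v + 2%:E * around v)%E.
Proof.
have md : measurable_fun setT (fun u => `|dot u v|).
  by apply: mabsdot.
have mi : measurable_fun setT (fun u => (\1_Om u * `|dot u v|)%:E).
  by apply/measurable_EFinP; apply: measurable_funM => //; exact: measurable_indic.
have i0 u : (0 <= (\1_Om u * `|dot u v|)%:E)%E by rewrite lee_fin mulr_ge0.
have mN := measurable_oppE3 (@measurable_id _ (E3 R) setT).
have mi' : measurable_fun setT (fun u => (\1_Om (- u) * `|dot u v|)%:E).
  apply/measurable_EFinP; apply: measurable_funM => //.
  exact: measurable_fun_inset.
have i0' u : (0 <= (\1_Om (- u) * `|dot u v|)%:E)%E by rewrite lee_fin mulr_ge0.
have mg : measurable_fun setT (fun u => (dihedral_gap Om u * `|dot u v|)%:E).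
  by apply/measurable_EFinP; apply: measurable_funM.
have g0 u : (0 <= (dihedral_gap Om u * `|dot u v|)%:E)%E.
  by rewrite lee_fin mulr_ge0// dihedral_gap_ge0.
have insideN : (\int[surface]_u (\1_Om (- u) * `|dot u v|)%:E = inside v)%E.
  rewrite /inside -[RHS]integral_opp_surface//.
  by apply: eq_integral => u _; rewrite dotNl normrN.
have pi2 : 0 <= 2 * pi ^+ 2 :> R by rewrite mulr_ge0 ?sqr_ge0.
transitivity (\int[surface]_u (((2 * pi ^+ 2)%:E * (\1_Om u * `|dot u v|)%:E +
    (2 * pi ^+ 2)%:E * (\1_Om (- u) * `|dot u v|)%:E) +
    2%:E * (dihedral_gap Om u * `|dot u v|)%:E))%E.
  apply: eq_integral => u _; rewrite -!EFinM -!EFinD /plane_weight; congr EFin; ring.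
rewrite ge0_integralD//; last 4 first.
- by move=> u _; rewrite adde_ge0// mule_ge0// lee_fin.
- by apply: emeasurable_funD; apply: emeasurable_funM.
- by move=> u _; rewrite mule_ge0.
- by apply: emeasurable_funM.
rewrite ge0_integralD//; last 4 first.
- by move=> u _; rewrite mule_ge0// lee_fin.
- by apply: emeasurable_funM.
- by move=> u _; rewrite mule_ge0// lee_fin.
- by apply: emeasurable_funM.
rewrite !ge0_integralZl// insideN -/(inside v) -/(around v).
rewrite -ge0_muleDl ?lee_fin//.
by rewrite -EFinD; congr ((_%:E * _) + _)%E; ring.
Qed.

Let total f : \bar R := (\int[surface]_(v in tilde Om) f v)%E.

Lemma alphaE : alpha Om = ((2^-1)%:E * total inside)%E.
Proof.
rewrite /alpha (integral_rectangle2 surface surface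
  (f := fun p => `|dot p.1 p.2|)).
- apply: (congr1 (mule _)); apply: eq_integral => v _.
  by rewrite integral_indic_mul.
- apply: measurable_funM; last by apply: mabsdot; msr.
  by apply: measurable_funM; apply: measurable_fun_inset => //; msr.
- by move=> p; rewrite mulr_ge0.
Qed.

Lemma gammaE : gamma Om = ((8^-1)%:E * total around)%E.
Proof.
rewrite /gamma (integral_rectangle1 surface surface
  (f := fun p => (dihedral Om p.2 ^+ 2 - sin (dihedral Om p.2) ^+ 2) *
                 `|dot p.1 p.2|)).
- apply: (congr1 (mule _)); apply: eq_integral => v _.
  rewrite integral_indic_mul; apply: eq_integral => u _.
  by rewrite /dihedral_gap mulrA [dot v u]dotC.
- rewrite (_ : (fun p => _) = fun p =>
    \1_(tilde Om) p.1 * dihedral_gap Om p.2 * `|dot p.1 p.2|); last first.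
    by apply/funext => p; rewrite /dihedral_gap !mulrA.
  apply: measurable_funM; last by apply: mabsdot; msr.
  apply: measurable_funM; first by apply: measurable_fun_inset => //; msr.
  by apply: (measurableT_comp mgap); msr.
- move=> p; rewrite (_ : _ * _ =
    \1_(tilde Om) p.1 * (dihedral_gap Om p.2 * `|dot p.1 p.2|)); last first.
    by rewrite /dihedral_gap; ring.
  by apply: mulr_ge0; [rewrite indicE|rewrite mulr_ge0// dihedral_gap_ge0].
Qed.

Lemma betaE : beta Om =
  ((16^-1)%:E * total (fun v => (4 * pi ^+ 2)%:E * inside v + 2%:E * around v))%E.
Proof.
have mAA : measurable (tilde Om `*` tilde Om) by exact: measurableX.
rewrite /beta (integral_rectangle2 (sf_product surface surface) surface
  (f := fun p => `|det3 p.1.1 p.1.2 p.2|)); last 2 first.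
- apply: measurable_funM; last by apply: measurable_absdet; msr.
  by apply: measurable_funM; apply: measurable_fun_inset => //; msr.
- by move=> p; rewrite mulr_ge0.
transitivity ((8^-1)%:E * \int[surface]_(v in tilde Om)
  ((2^-1)%:E * ((4 * pi ^+ 2)%:E * inside v + 2%:E * around v)))%E.
  congr (_ * _)%E; apply: eq_integral => v _.
  rewrite (integral_rectangle1 surface surface
    (f := fun p => `|det3 p.1 p.2 v|)); last 2 first.
  - apply: measurable_funM; last by apply: (measurable_absdet (h := cst v)); msr.
    by apply: measurable_funM; apply: measurable_fun_inset => //; msr.
  - by move=> p; rewrite mulr_ge0.
  by rewrite integral_det_pair// integral_plane_weight_dot.
rewrite ge0_integralZl//.
- by rewrite muleA -EFinM; congr (_%:E * _)%E; field.
- apply: measurable_funTS.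
  by apply: emeasurable_funD; apply: emeasurable_funM.
- move=> v _; rewrite adde_ge0// mule_ge0//.
  by rewrite lee_fin mulr_ge0// sqr_ge0.
Qed.

Lemma beta_alpha_gamma :
  beta Om = (((pi ^+ 2 / 2)%:E * alpha Om) + gamma Om)%E.
Proof.
rewrite betaE alphaE gammaE [X in (_ * X)%E = _]/total.
have pi4 : 0 <= 4 * pi ^+ 2 :> R by rewrite mulr_ge0 ?sqr_ge0.
have minsideA := measurable_funTS (D := tilde Om) minside.
have maroundA := measurable_funTS (D := tilde Om) maround.
have total_linear : (\int[surface]_(v in tilde Om)
    ((4 * pi ^+ 2)%:E * inside v + 2%:E * around v) =
    (4 * pi ^+ 2)%:E * total inside + 2%:E * total around)%E.
  rewrite ge0_integralD; [|exact: mA| | | |].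
  - by rewrite !ge0_integralZl.
  - by move=> v _; rewrite mule_ge0.
  - exact: emeasurable_funM.
  - by move=> v _; rewrite mule_ge0.
  - exact: emeasurable_funM.
have total0 f : (forall v, 0 <= f v)%E -> (0 <= total f)%E.
  by move=> f0; apply: integral_ge0.
rewrite total_linear ge0_muleDr; last 2 first.
- by rewrite mule_ge0// total0.
- by rewrite mule_ge0// total0.
rewrite !muleA -!EFinM -/(total inside) -/(total around).
have -> : 16^-1 * (4 * pi ^+ 2) = pi ^+ 2 / 2 / 2 :> R by field.
by have -> : 16^-1 * 2 = 8^-1 :> R by field.
Qed.

End crofton.

Theorem mainTheorem7 (R : realType) (Omega : set (E3 R))
    (hOmega : spherically_convex Omega) :
  beta Omega = (((pi ^+ 2 / 2)%:E * alpha Omega) + gamma Omega)%E.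
Proof. exact: beta_alpha_gamma. Qed.
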